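(* Let $\{Y^f_\mu(t)\}_{t\ge0}$, $Y^f_\mu(t)=Y^f(G_\mu(t))$, be the geometric subordinated compound Poisson process with i.i.d. jumps $X_1,X_2,\dots$, Poisson intensity $\lambda>0$ and geometric parameter $\mu>0$, where $\mathbb{E}[X_1^2]<\infty$ and $\mathbb{E}[(N^f(t))^r]<\infty$ for all $r>0$ (and all $t$). Then for $0<s\le t<\infty$: (i) $\mathbb{E}[Y^f_\mu(t)]=\lambda\mu t\,\mathbb{E}[D^f(1)]\,\mathbb{E}[X_1]$; (ii) $\mathrm{Var}[Y^f_\mu(t)]=\lambda\mu t\left[\mathbb{E}[D^f(1)]\,\mathrm{Var}[X_1]+(\mathbb{E}[X_1])^2\left(\lambda\,\mathrm{Var}[D^f(1)]+\mathbb{E}[D^f(1)]\right)\right]+\lambda^2\mu t\,(\mathbb{E}[D^f(1)])^2(\mathbb{E}[X_1])^2(1+\mu t)$; (iii) $\mathrm{Cov}[Y^f_\mu(t),Y^f_\mu(s)]=\mu s\left(\lambda\,\mathbb{E}[X_1^2]\,\mathbb{E}[D^f(1)]+(\mathbb{E}[X_1])^2\lambda^2\,\mathrm{Var}[D^f(1)]\right)+\lambda^2(\mathbb{E}[D^f(1)])^2(\mathbb{E}[X_1])^2\,\mu s(1+\mu t)$.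
   Context: $\{D^f(t)\}_{t\ge0}$ is a Lévy subordinator (non-decreasing Lévy process) with Laplace transform $\mathbb{E}[e^{-sD^f(t)}]=e^{-tf(s)}$, where $f(s)=bs+\int_0^\infty(1-e^{-sx})\,\nu(dx)$, $b\ge0$, is a Bernstein function, and $\nu$ is a Lévy measure on the positive half-line with $\int_0^\infty (x\wedge 1)\,\nu(dx)<\infty$ and infinite total mass. $\{N(t)\}_{t\ge0}$ is a homogeneous Poisson process with intensity $\lambda>0$, independent of $D^f$, and $N^f(t)=N(D^f(t))$ is the subordinated Poisson process. $X_1,X_2,\dots$ are i.i.d. random variables (jumps) with common distribution function $F_X$, independent of $N^f$. The generalized compound Poisson process is $Y^f(t)=\sum_{i=1}^{N^f(t)}X_i$ (empty sum $=0$). The geometric counting process $\{G_\mu(t)\}_{t\ge0}$ with parameter $\mu>0$ is the mixed Poisson process whose random rate is exponentially distributed with mean $\mu$ (conditionally on the rate $\Lambda$, it is a Poisson process of intensity $\Lambda$); in particular $\mathbb{P}[G_\mu(t)=k]=\frac{1}{1+\mu t}\left(\frac{\mu t}{1+\mu t}\right)^k$, $k=0,1,2,\dots$. The geometric subordinated compound Poisson process is $Y^f_\mu(t)=Y^f(G_\mu(t))$ with $G_\mu$ independent of $Y^f$. *)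

(* Defs.v *)
From mathcomp Require Import all_boot all_order all_algebra finmap.
From mathcomp Require Import all_classical all_reals all_analysis.

Set Implicit Arguments.
Unset Strict Implicit.
Unset Printing Implicit Defensive.

Import Order.TTheory GRing.Theory Num.Theory.
Import numFieldNormedType.Exports.
Local Open Scope classical_set_scope.
Local Open Scope ring_scope.

(* Processes in continuous time are families indexed by all of R; only the
   times t >= 0 are ever constrained or used. *)

(* The independence hypotheses below concern whole processes, hence the
   sigma-algebra generated by the variables Z i, i \in A, together. *)
Definition process_sigma d d' (T : measurableType d) (U : measurableType d')
    (I : Type) (A : set I) (Z : I -> T -> U) : set (set T) :=
  <<s \bigcup_(i in A) [set C | exists2 B, measurable B & C = Z i @^-1` B] >>.

Definition independent_processes d d1 d2 (T : measurableType d)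
    (U1 : measurableType d1) (U2 : measurableType d2) (R : realType)
    (P : probability T R) (I1 I2 : Type)
    (A1 : set I1) (Z1 : I1 -> T -> U1) (A2 : set I2) (Z2 : I2 -> T -> U2) :=
  forall C1 C2, process_sigma A1 Z1 C1 -> process_sigma A2 Z2 C2 ->
    P (C1 `&` C2) = (P C1 * P C2)%E.

Definition mutually_independent d (T : measurableType d) (R : realType)
    (P : probability T R) (I : choiceType) (Z : I -> T -> R) :=
  forall (J : {fset I}) (B : I -> set R), (forall i, measurable (B i)) ->
    P (\bigcap_(i in [set` J]) Z i @^-1` B i) =
    (\prod_(i <- J) P (Z i @^-1` B i))%E.

Definition iid d (T : measurableType d) (R : realType) (P : probability T R)
    (X : nat -> {RV P >-> R}) (F : R -> \bar R) :=
  mutually_independent P (fun i w => X i w) /\ forall i, cdf (X i) = F.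

Definition time_sequence (R : realType) (t : nat -> R) :=
  0 <= t 0%N /\ forall i, t i < t i.+1.

Definition independent_increments d (T : measurableType d) (R : realType)
    (P : probability T R) (Z : R -> T -> R) :=
  forall t : nat -> R, time_sequence t ->
    mutually_independent P (fun (i : nat) w => Z (t i.+1) w - Z (t i) w).

Definition stationary_increments d (T : measurableType d) (R : realType)
    (P : probability T R) (Z : R -> T -> R) :=
  forall s t (B : set R), 0 <= s -> 0 <= t -> measurable B ->
    P [set w | B (Z (s + t) w - Z s w)] = P [set w | B (Z t w - Z 0 w)].

Definition cadlag (R : realType) (x : R -> R) :=
  (forall t, 0 <= t -> x u @[u --> t^'+] --> x t) /\
  (forall t, 0 < t -> cvg (x u @[u --> t^'-])).

(* Path properties are required of every path. Right-continuity makes t |-> Z t w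
   jointly measurable, so that subordinated processes are random variables;
   together with stationary increments it also yields stochastic continuity. *)
Record levy_process d (T : measurableType d) (R : realType)
    (P : probability T R) (Z : R -> {RV P >-> R}) : Prop := LevyProcess {
  levy_start : forall w, Z 0 w = 0 ;
  levy_indep : independent_increments P (fun t w => Z t w) ;
  levy_stat : stationary_increments P (fun t w => Z t w) ;
  levy_cadlag : forall w, cadlag (fun t => Z t w) }.

Definition levy_subordinator d (T : measurableType d) (R : realType)
    (P : probability T R) (D : R -> {RV P >-> R}) :=
  levy_process D /\
  forall w s t, 0 <= s -> s <= t -> D s w <= D t w.

Record levy_measure (R : realType) (nu : {measure set R -> \bar R}) : Prop :=
  LevyMeasure {
  levy_measure_support : nu `]-oo, 0]%classic = 0%E ;
  levy_measure_int :
    (\int[nu]_(x in `]0%R, +oo[) (Num.min x 1)%:E < +oo)%E ;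
  levy_measure_infinite : nu `]0, +oo[%classic = +oo%E }.

Definition bernstein (R : realType) (b : R) (nu : {measure set R -> \bar R})
    (s : R) : R :=
  b * s + \int[nu]_(x in `]0, +oo[) (1 - expR (- (s * x))).

Definition has_laplace_exponent d (T : measurableType d) (R : realType)
    (P : probability T R) (D : R -> {RV P >-> R}) (f : R -> R) :=
  forall s t, 0 <= s -> 0 <= t ->
    ('E_P[fun w => expR (- (s * D t w))%R] = (expR (- (t * f s)))%:E)%E.

Record counting_process d (T : measurableType d) (R : realType)
    (P : probability T R) (N : R -> {RV P >-> nat}) : Prop := CountingProcess {
  counting_start : forall w, N 0 w = 0%N ;
  counting_mono : forall w s t, 0 <= s -> s <= t -> (N s w <= N t w)%N ;
  counting_cadlag : forall w, cadlag (fun t => (N t w)%:R : R) }.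

Record poisson_process d (T : measurableType d) (R : realType)
    (P : probability T R) (lambda : R) (N : R -> {RV P >-> nat}) : Prop :=
  PoissonProcess {
  poisson_counting : counting_process N ;
  poisson_indep : independent_increments P (fun t w => (N t w)%:R) ;
  poisson_law : forall s t k, 0 <= s -> s < t ->
    P [set w | N t w = (N s w + k)%N] =
    (poisson_pmf (lambda * (t - s)) k)%:E }.

(* Conditionally on L, the increments of G over consecutive intervals are
   independent and Poisson with parameter L times the length; the conditional
   law is expressed by integrating over the events L \in B. *)
Definition mixed_poisson_process d (T : measurableType d) (R : realType)
    (P : probability T R) (L : {RV P >-> R}) (G : R -> {RV P >-> nat}) :=
  counting_process G /\
  forall (n : nat) (t : nat -> R) (k : nat -> nat) (B : set R),
    time_sequence t -> measurable B ->
    P (L @^-1` B `&`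
       \bigcap_(i in `I_n) [set w | G (t i.+1) w = (G (t i) w + k i)%N]) =
    (\int[P]_(w in L @^-1` B)
       (\prod_(i < n) poisson_pmf (L w * (t i.+1 - t i)) (k i))%:E)%E.

(* exponential_prob takes the rate, that is the inverse of the mean mu. *)
Definition geometric_counting_process d (T : measurableType d) (R : realType)
    (P : probability T R) (mu : R) (G : R -> {RV P >-> nat}) :=
  exists L : {RV P >-> R},
    (forall B : set R, measurable B ->
       distribution P L B = exponential_prob mu^-1 B) /\
    mixed_poisson_process L G.

Definition subordinated_poisson (T : Type) (R : realType)
    (N : R -> T -> nat) (D : R -> T -> R) (t : R) (w : T) : nat :=
  N (D t w) w.

(* The jump X_i of the usual one-based numbering is X i.-1. *)
Definition compound_process (T : Type) (R : realType)
    (M : R -> T -> nat) (X : nat -> T -> R) (t : R) (w : T) : R :=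
  \sum_(i < M t w) X i w.

Definition geometric_subordinated (T : Type) (R : realType)
    (Y : R -> T -> R) (G : R -> T -> nat) (t : R) (w : T) : R :=
  Y (G t w)%:R w.

(* Main.v *)
From HB Require Import structures.
Require Import Defs.
From mathcomp Require Import all_boot all_order all_algebra finmap.
From mathcomp Require Import all_classical all_reals all_analysis.
From mathcomp Require Import measurable_realfun zify ring lra.
Import Order.TTheory GRing.Theory Num.Theory.
Import numFieldNormedType.Exports.
Local Open Scope classical_set_scope.
Local Open Scope ring_scope.

(** Call a sequence W of random variables of type (alpha, p, q) when
    E[W_m] = m alpha and E[W_m W_n] = min(m, n) p + m n q.  Partial sums of
    pairwise independent, identically distributed square integrable variables
    are of such a type, and for random indices M, N independent of W one gets
    E[W_M] = alpha E[M] and E[W_M W_N] = p E[min(M, N)] + q E[M N].  This is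
    used twice: W the partial sums of the jumps with indices N^f(j), N^f(k),
    then W_j = Y^f(j) with indices G(s), G(t).

    The moments of N^f follow from those of N and D by sampling the time change
    on a grid of mesh r: there D takes countably many values, so that one can
    condition on them, and since N is nondecreasing the moments of N(D) are
    squeezed between those at the two neighbouring grid points.  The same
    sampling from below shows that D(1) is square integrable as soon as N^f(1)
    is.  The moments of D at integer times are those of partial sums of its
    increments, and both N and G are mixed Poisson processes, whose product
    moments are obtained from the law of single increments by polarization. *)

(** * Random variables with a finite mean *)

Section mean.
Context {d} {T : measurableType d} {R : realType} (P : probability T R).
Implicit Types (f g h : T -> R) (a b m : R).

(** Integrability is bundled with a real value of the mean, so that all moment computations take
    place in [R]; extended reals return only in the final identities. *)
Definition has_mean f m :=
  P.-integrable setT (EFin \o f) /\ (\int[P]_w (f w)%:E = m%:E)%E.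

Lemma has_mean_measurable f m : has_mean f m -> measurable_fun setT f.
Proof. by move=> [/integrableP[+ _] _] => /measurable_EFinP. Qed.

Lemma has_mean_uniq f m1 m2 : has_mean f m1 -> has_mean f m2 -> m1 = m2.
Proof. by move=> [_ +] [_ e2]; rewrite e2 => -[]. Qed.

Lemma integrable_has_mean f : P.-integrable setT (EFin \o f) ->
  exists m, has_mean f m.
Proof.
move=> fi; exists (fine (\int[P]_w (f w)%:E)%E); split => //.
by rewrite fineK//; exact: integrable_fin_num.
Qed.

Lemma has_mean_ge0 f m : measurable_fun setT f -> (forall w, 0 <= f w) ->
  (\int[P]_w (f w)%:E = m%:E)%E -> has_mean f m.
Proof.
move=> mf f0 e; split => //; apply/integrableP; split.
  exact/measurable_EFinP.
by under eq_integral do rewrite /= ger0_norm//; rewrite e ltry.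
Qed.

Lemma has_mean_lty f : measurable_fun setT f -> (forall w, 0 <= f w) ->
  (\int[P]_w (f w)%:E < +oo)%E -> exists m, has_mean f m.
Proof.
move=> mf f0 foo; apply: integrable_has_mean; apply/integrableP; split.
  exact/measurable_EFinP.
by under eq_integral do rewrite /= ger0_norm//.
Qed.

Lemma has_mean_dominated f g m : measurable_fun setT f ->
  (forall w, `|f w| <= g w) -> has_mean g m -> exists m', has_mean f m'.
Proof.
move=> mf fg [gi _]; apply: integrable_has_mean.
apply: (le_integrable _ _ _ gi) => //; first exact/measurable_EFinP.
by move=> w _ /=; rewrite lee_fin (le_trans (fg w))// ler_norm.
Qed.

Lemma has_mean_le f g a b : (forall w, f w <= g w) ->
  has_mean f a -> has_mean g b -> a <= b.
Proof.
move=> fg [fi fa] [gi gb]; rewrite -lee_fin -fa -gb.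
by apply: le_integral => // w _ /=; rewrite lee_fin.
Qed.

Lemma has_mean_cst a : has_mean (cst a) a.
Proof.
split; first by apply: finite_measure_integrable_cst.
by rewrite /= integral_cst//= probability_setT mule1.
Qed.

Lemma has_meanD f g a b : has_mean f a -> has_mean g b ->
  has_mean (fun w => f w + g w) (a + b).
Proof.
move=> [fi fa] [gi gb]; split.
  by rewrite (_ : EFin \o _ = (EFin \o f) \+ (EFin \o g))%E//; exact: integrableD.
by rewrite EFinD -fa -gb -integralD.
Qed.

Lemma has_meanZ k f a : has_mean f a -> has_mean (fun w => k * f w) (k * a).
Proof.
move=> [fi fa]; split.
  rewrite (_ : EFin \o _ = (fun w => k%:E * (EFin \o f) w))%E//.
  exact: integrableZl.
by rewrite EFinM -fa -integralZl.
Qed.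

Lemma has_meanN f a : has_mean f a -> has_mean (fun w => - f w) (- a).
Proof.
by move=> /(has_meanZ (-1)); under eq_fun do rewrite mulN1r; rewrite mulN1r.
Qed.

Lemma has_meanB f g a b : has_mean f a -> has_mean g b ->
  has_mean (fun w => f w - g w) (a - b).
Proof. by move=> fa /has_meanN; exact: has_meanD. Qed.

(** From (|f| - 1)^2 >= 0 one gets |f| <= (1 + f^2) / 2, which is integrable since P is finite. *)
Lemma has_mean_square_integrable f m : measurable_fun setT f ->
  has_mean (fun w => f w ^+ 2) m -> exists m', has_mean f m'.
Proof.
move=> mf fm; apply: (has_mean_dominated f (fun w => 2^-1 * (1 + f w ^+ 2))
  (2^-1 * (1 + m))) => //.
  move=> w; have := sqr_ge0 (`|f w| - 1).
  by rewrite -(real_normK (num_real (f w))); lra.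
by apply: has_meanZ; apply: has_meanD => //; exact: has_mean_cst.
Qed.

Lemma has_mean_sum (I : Type) (r : seq I) (F : I -> T -> R) (m : I -> R) :
  (forall i, has_mean (F i) (m i)) ->
  has_mean (fun w => \sum_(i <- r) F i w) (\sum_(i <- r) m i).
Proof.
move=> Fm; elim: r => [|i r IH].
  under eq_fun do rewrite big_nil.
  by rewrite big_nil; exact: has_mean_cst.
under eq_fun do rewrite big_cons.
by rewrite big_cons; exact: has_meanD.
Qed.

Lemma has_mean_expectation f m : has_mean f m -> ('E_P[f] = m%:E)%E.
Proof. by move=> [_ <-]; rewrite unlock. Qed.

Lemma has_mean_covariance f g a b m : has_mean f a -> has_mean g b ->
  has_mean (fun w => f w * g w) m -> covariance P f g = (m - a * b)%:E.
Proof.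
move=> fa gb fgm.
have L h c : has_mean h c -> h \in Lfun P 1.
  by move=> [? _]; apply/Lfun1_integrable.
rewrite covarianceE; [|exact: L fa|exact: L gb|exact: (L (f * g) _ fgm)].
rewrite (has_mean_expectation _ _ fa) (has_mean_expectation _ _ gb).
by rewrite (has_mean_expectation (f * g) _ fgm).
Qed.

Lemma has_mean_funrposneg f m : has_mean f m ->
  exists p n, [/\ has_mean f^\+ p, has_mean f^\- n & m = p - n].
Proof.
move=> fm; have [fi _] := fm.
have [p fp] := integrable_has_mean _ (integrable_funrpos measurableT fi).
have [n fn] := integrable_has_mean _ (integrable_funrneg measurableT fi).
exists p, n; split => //; apply: (has_mean_uniq f) => //.
by rewrite -{1}(funrposBneg f); exact: has_meanB.
Qed.

Definition same_law f g := forall B, measurable B ->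
  P (f @^-1` B) = P (g @^-1` B).

(** Both means are integrals of [h] against one and the same pushforward measure. *)
Lemma has_mean_same_law f g (h : R -> R) m :
  measurable_fun setT f -> measurable_fun setT g -> same_law f g ->
  measurable_fun setT h -> has_mean (h \o f) m -> has_mean (h \o g) m.
Proof.
move=> mf mg fg mh [hfi hfm].
have mEh : measurable_fun setT (EFin \o h) by exact/measurable_EFinP.
have eqfg (k : R -> \bar R) D : measurable D ->
    (\int[pushforward P f]_(x in D) k x = \int[pushforward P g]_(x in D) k x)%E.
  by move=> mD; apply: eq_measure_integral => B mB _; exact: fg.
have hgi : P.-integrable setT (EFin \o (h \o g)).
  apply/integrableP; split; first exact/measurable_EFinP/measurableT_comp.
  move/integrableP : hfi => [_]; apply: le_lt_trans.
  have := eqfg (fun x => `|(EFin \o h) x|)%E setT measurableT.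
  rewrite !ge0_integral_pushforward//; do ?[by move=> *; exact: abse_ge0];
   do ?[exact: measurableT_comp].
  by rewrite !preimage_setT => ->.
split => //.
have := eqfg (EFin \o h) setT measurableT.
rewrite !integral_pushforward//= !preimage_setT.
by move=> <-.
Qed.

End mean.

(** * Independence *)

Lemma measurable_preimage d d' (T : measurableType d) (U : measurableType d')
    (f : T -> U) (B : set U) :
  measurable_fun setT f -> measurable B -> measurable (f @^-1` B).
Proof. by move=> mf mB; have := mf measurableT _ mB; rewrite setTI. Qed.

Section independence.
Context {d} {T : measurableType d} {R : realType} (P : probability T R).
Implicit Types (f g h : T -> R) (a b m : R).

Definition independent_functions f g := forall A B : set R,
  measurable A -> measurable B ->
  (P (f @^-1` A `&` g @^-1` B) = P (f @^-1` A) * P (g @^-1` B))%E.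

(** Conditioning on a countable variable needs independence from one fibre E at a time, which is
    what the process hypotheses deliver directly. *)
Definition independent_of_event f (E : set T) := forall B : set R,
  measurable B -> (P (f @^-1` B `&` E) = P (f @^-1` B) * P E)%E.

Lemma independent_functions_comp f g (k l : R -> R) :
  measurable_fun setT k -> measurable_fun setT l ->
  independent_functions f g -> independent_functions (k \o f) (l \o g).
Proof.
by move=> mk ml fg A B mA mB; apply: (fg (k @^-1` A) (l @^-1` B));
  exact: measurable_preimage.
Qed.

Lemma independent_of_event_comp f (k : R -> R) E :
  measurable_fun setT k -> independent_of_event f E ->
  independent_of_event (k \o f) E.
Proof.
by move=> mk fE B mB; apply: (fE (k @^-1` B)); exact: measurable_preimage.
Qed.

(** The joint law agrees with the product of the marginal laws on rectangles, hence everywhere by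
    uniqueness of the product measure; Tonelli then factors the integral. *)
Lemma ge0_independent_integralM f g :
  measurable_fun setT f -> measurable_fun setT g ->
  (forall w, 0 <= f w) -> (forall w, 0 <= g w) ->
  independent_functions f g ->
  (\int[P]_w (f w * g w)%:E = (\int[P]_w (f w)%:E) * \int[P]_w (g w)%:E)%E.
Proof.
move=> mf mg f0 g0 fg.
pose X : {RV P >-> R} := HB.pack f (isMeasurableFun.Build _ _ _ _ f mf).
pose Y : {RV P >-> R} := HB.pack g (isMeasurableFun.Build _ _ _ _ g mg).
have mXY : measurable_fun setT (fun w => (f w, g w)) by exact: measurable_fun_pair.
pose XY : {RV P >-> (R * R)%type} :=
  HB.pack (fun w => (f w, g w))
    (isMeasurableFun.Build _ _ _ _ (fun w => (f w, g w)) mXY).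
(* The absolute value makes the integrand nonnegative on the whole plane without changing it at the
   values of (f, g). *)
pose k (z : R * R) : \bar R := `|z.1 * z.2|%:E.
have mk : measurable_fun setT k.
  apply/measurable_EFinP; apply: measurableT_comp => //.
  by apply: measurable_funM; [exact: measurable_fst|exact: measurable_snd].
have k0 z : (0 <= k z)%E by rewrite lee_fin.
have E1 : (\int[P]_w (f w * g w)%:E = \int[distribution P XY]_z k z)%E.
  rewrite ge0_integral_distribution//.
  by apply: eq_integral => w _; rewrite /k /= ger0_norm// mulr_ge0.
have mabs : measurable_fun setT (fun z : R => `|z|%:E).
  by have /measurable_EFinP := @normr_measurable R setT.
have E2 (Z : {RV P >-> R}) : (forall w, 0 <= Z w) ->
    (\int[P]_w (Z w)%:E = \int[distribution P Z]_z `|z|%:E)%E.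
  move=> Z0; rewrite ge0_integral_distribution//.
  by apply: eq_integral => w _ /=; rewrite ger0_norm.
rewrite E1 (E2 X f0) (E2 Y g0).
transitivity (\int[(distribution P X \x distribution P Y)%E]_z k z)%E.
  apply: eq_measure_integral => A mA _; apply/esym.
  by apply: product_measure_unique => // B C mB mC; exact: fg.
rewrite fubini_tonelli1//.
under eq_integral => x _.
  rewrite /fubini_F /k /=.
  under eq_integral do rewrite normrM EFinM.
  rewrite ge0_integralZl//; over.
rewrite ge0_integralZr//.
by apply: integral_ge0 => ? _; rewrite lee_fin.
Qed.

Lemma ge0_independent_integral_event f (E : set T) :
  measurable_fun setT f -> measurable E -> (forall w, 0 <= f w) ->
  independent_of_event f E ->
  (\int[P]_(w in E) (f w)%:E = (\int[P]_w (f w)%:E) * P E)%E.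
Proof.
move=> mf mE f0 fE.
have mfA (A : set R) : measurable A -> measurable (f @^-1` A).
  exact: measurable_preimage.
rewrite -[in RHS](setIT E) -integral_indic//.
(* The preimage of B under the indicator is the whole space, E, its complement or empty, according
   to whether 1 and 0 lie in B. *)
have fI : independent_functions f (\1_E : T -> R).
  move=> A B mA mB; rewrite preimage_indic.
  case: ifPn => _; case: ifPn => _.
  - by rewrite setIT probability_setT mule1.
  - exact: fE.
  - rewrite -setDE measureD//; last 2 first.
      exact: mfA.
      by rewrite (le_lt_trans (probability_le1 _ _))// ?ltry//; exact: mfA.
    rewrite probability_setC// muleBr//.
      by rewrite mule1; congr (_ - _)%E; exact: fE.
    by apply: fin_num_measure; exact: mfA.
  - by rewrite setI0 measure0 mule0.
rewrite -ge0_independent_integralM//.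
rewrite integral_mkcond; apply: eq_integral => w _.
by rewrite patchE indicE; case: (w \in E); rewrite ?mulr1 ?mulr0.
Qed.

(** Splitting both factors into positive and negative parts leaves four products of nonnegative
    independent functions. *)
Lemma has_meanM f g a b : has_mean P f a -> has_mean P g b ->
  independent_functions f g -> has_mean P (fun w => f w * g w) (a * b).
Proof.
move=> fa gb fg.
have mf := has_mean_measurable _ _ _ fa.
have mg := has_mean_measurable _ _ _ gb.
have [fp [fn [fpm fnm ->]]] := has_mean_funrposneg _ _ _ fa.
have [gp [gn [gpm gnm ->]]] := has_mean_funrposneg _ _ _ gb.
have M (k l : R -> R) x y : (forall z, 0 <= k z) -> (forall z, 0 <= l z) ->
    measurable_fun setT k -> measurable_fun setT l ->
    has_mean P (k \o f) x -> has_mean P (l \o g) y ->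
    has_mean P (fun w => k (f w) * l (g w)) (x * y).
  move=> k0 l0 mk ml kx ly.
  have mkf : measurable_fun setT (k \o f) by exact: measurableT_comp.
  have mlg : measurable_fun setT (l \o g) by exact: measurableT_comp.
  apply: has_mean_ge0.
  - exact: measurable_funM.
  - by move=> w; rewrite mulr_ge0.
  - rewrite (ge0_independent_integralM (k \o f) (l \o g))//.
    - by rewrite kx.2 ly.2.
    - by move=> w; exact: k0.
    - by move=> w; exact: l0.
    - exact: independent_functions_comp.
pose p : R -> R := (@idfun R)^\+; pose n : R -> R := (@idfun R)^\-.
have p0 x : 0 <= p x by exact: funrpos_ge0.
have n0 x : 0 <= n x by exact: funrneg_ge0.
have mp : measurable_fun setT p by apply: measurable_funrpos; exact: measurable_id.
have mn : measurable_fun setT n by apply: measurable_funrneg; exact: measurable_id.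
have pnE x : x = p x - n x by have /(congr1 (@^~ x))/= := funrposBneg (@idfun R).
rewrite (_ : (fun w => _) = fun w => (p (f w) * p (g w) - p (f w) * n (g w)) -
   (n (f w) * p (g w) - n (f w) * n (g w))).
  rewrite (_ : _ * _ = (fp * gp - fp * gn) - (fn * gp - fn * gn)); last by ring.
  by apply: has_meanB; apply: has_meanB; apply: M.
by apply/funext => w; rewrite {1}(pnE (f w)) {1}(pnE (g w)); ring.
Qed.

End independence.

(** * Conditioning on a countable variable *)

Section freezing.
Context {d} {T : measurableType d} {R : realType} (P : probability T R).
Context {I : countType} (K : T -> I).
Hypothesis mK : forall i, measurable (K @^-1` [set i]).

(** The fibres of [K] are indexed by the codes of the values in [nat], with empty sets at codes of
    no value, so that sigma-additivity applies to a sequence. The partial inverse [pickle_inv] is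
    injective where defined, which keeps them disjoint. *)
Let fiber n := if @pickle_inv I n is Some i then K @^-1` [set i] else set0.

Let fiberP n w : fiber n w -> pickle_inv n = Some (K w).
Proof. by rewrite /fiber; case: pickle_inv => //= i <-. Qed.

Let measurable_fiber n : measurable (fiber n).
Proof. by rewrite /fiber; case: pickle_inv. Qed.

Let bigcup_fiber : \bigcup_n fiber n = setT.
Proof.
apply/seteqP; split => // w _; exists (choice.pickle (K w)) => //.
by rewrite /fiber pickleK_inv.
Qed.

Let trivIset_fiber : trivIset setT fiber.
Proof.
move=> n m _ _ [w [/fiberP nw /fiberP mw]].
by rewrite -(@pickle_invK I n) nw -(@pickle_invK I m) mw.
Qed.

Lemma measurable_freeze d' (U : measurableType d') (F : I -> T -> U) :
  (forall i, measurable_fun setT (F i)) ->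
  measurable_fun setT (fun w => F (K w) w).
Proof.
move=> mF _ B mB; rewrite setTI.
rewrite (_ : _ @^-1` _ = \bigcup_n (fiber n `&`
    if @pickle_inv I n is Some i then F i @^-1` B else set0)); last first.
  apply/seteqP; split=> w.
    move=> BFw; have : (\bigcup_n fiber n) w by rewrite bigcup_fiber.
    by move=> [n _ nw]; exists n => //; split => //; rewrite (fiberP _ _ nw).
  by move=> [n _ [/fiberP ->]].
apply: bigcupT_measurable => n; apply: measurableI => //.
by case: pickle_inv => // i; exact: measurable_preimage.
Qed.

(** On the fibre over i the integrand is [F i], independent of that fibre, so its integral there is
    [phi i] times the mass of the fibre; the fibres are then summed. *)
Lemma ge0_integral_freeze (F : I -> T -> R) (phi : I -> R) :
  (forall i w, 0 <= F i w) ->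
  (forall i, independent_of_event P (F i) (K @^-1` [set i])) ->
  (forall i, has_mean P (F i) (phi i)) ->
  (\int[P]_w (F (K w) w)%:E = \int[P]_w (phi (K w))%:E)%E.
Proof.
move=> F0 indF Fphi.
have mF i : measurable_fun setT (F i) by exact: has_mean_measurable (Fphi i).
have phi0 i : 0 <= phi i.
  by apply: (has_mean_le P (cst 0) (F i)) => //; exact: has_mean_cst.
rewrite -bigcup_fiber !ge0_integral_bigcup//; last 4 first.
- rewrite bigcup_fiber; apply/measurable_EFinP.
  by apply: (measurable_freeze _ _ (fun i _ => phi i)).
- by move=> w _; rewrite lee_fin.
- by rewrite bigcup_fiber; apply/measurable_EFinP; exact: measurable_freeze.
- by move=> w _; rewrite lee_fin.
apply: eq_eseriesr => n _.
have := fiberP n; have := measurable_fiber n.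
rewrite /fiber; case: pickle_inv => [i|]; last by rewrite !integral_set0.
move=> mKi _.
transitivity (\int[P]_(w in K @^-1` [set i]) (F i w)%:E)%E.
  by apply: eq_integral => w; rewrite inE /= => ->.
rewrite ge0_independent_integral_event// (Fphi i).2.
transitivity (\int[P]_(w in K @^-1` [set i]) (cst (phi i)%:E w))%E.
  by rewrite integral_cst.
by apply: eq_integral => w; rewrite inE /= => ->.
Qed.

Lemma has_mean_freeze (F : I -> T -> R) (phi psi : I -> R) m b :
  (forall i, independent_of_event P (F i) (K @^-1` [set i])) ->
  (forall i, has_mean P (F i) (phi i)) ->
  (forall i, exists2 H, has_mean P H (psi i) & forall w, `|F i w| <= H w) ->
  has_mean P (psi \o K) b -> has_mean P (phi \o K) m ->
  has_mean P (fun w => F (K w) w) m.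
Proof.
move=> indF Fphi Fpsi psib phim.
have mF i : measurable_fun setT (F i) by exact: has_mean_measurable (Fphi i).
have mFK : measurable_fun setT (fun w => F (K w) w) by exact: measurable_freeze.
(* Used three times: k the absolute value for integrability, then k the positive and the negative
   part for the value of the mean. *)
have meanE (k : R -> R) : measurable_fun setT k -> (forall x, 0 <= k x <= `|x|) ->
    exists kphi : I -> R, [/\ forall i, has_mean P (k \o F i) (kphi i),
      forall i, 0 <= kphi i <= psi i &
      (\int[P]_w (k (F (K w) w))%:E = \int[P]_w (kphi (K w))%:E)%E].
  move=> mk k0.
  have kF i : exists m', has_mean P (k \o F i) m'.
    have [H Hpsi FH] := Fpsi i.
    apply: (has_mean_dominated _ _ H _ _ _ Hpsi); first exact: measurableT_comp.
    move=> w /=; have /andP[k0w kw] := k0 (F i w).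
    by rewrite ger0_norm// (le_trans kw).
  pose kphi i := projT1 (cid (kF i)).
  have kphiE i : has_mean P (k \o F i) (kphi i) by rewrite /kphi; case: cid.
  exists kphi; split => //.
    move=> i; have [H Hpsi FH] := Fpsi i; apply/andP; split.
      apply: (has_mean_le P (cst 0) (k \o F i)) => //; last exact: has_mean_cst.
      by move=> w /=; have /andP[] := k0 (F i w).
    apply: (has_mean_le _ _ _ _ _ _ (kphiE i) Hpsi) => w /=.
    by have /andP[_ /le_trans] := k0 (F i w); apply.
  apply: (ge0_integral_freeze (fun i => k \o F i)) => //.
    by move=> i w /=; have /andP[] := k0 (F i w).
  by move=> i; exact: independent_of_event_comp.
have mkphi (kphi : I -> R) : measurable_fun setT (kphi \o K).
  exact: (measurable_freeze _ _ (fun i _ => kphi i)).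
have [m' Fm'] : exists m', has_mean P (fun w => F (K w) w) m'.
  have [] := meanE (@Num.norm _ R).
  - exact: normr_measurable.
  - by move=> x; rewrite normr_ge0 lexx.
  move=> aphi [_ aphi_le aE].
  have [n0 Hn0] : exists n0, has_mean P (fun w => `|F (K w) w|) n0.
    apply: has_mean_lty => //; first exact: measurableT_comp.
    rewrite aE -[X in (X < _)%E]/(\int[P]_w ((EFin \o (aphi \o K)) w))%E.
    have [n0 [_ ->]] : exists n0, has_mean P (aphi \o K) n0; last by rewrite ltry.
    apply: (has_mean_dominated _ _ _ _ _ _ psib) => // w /=.
    by have /andP[a0 ?] := aphi_le (K w); rewrite ger0_norm.
  exact: (has_mean_dominated _ _ _ _ _ _ Hn0).
rewrite (_ : m = m')//.
have [p [n [Fp Fn m'E]]] := has_mean_funrposneg _ _ _ Fm'.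
have pos0 (x : R) : 0 <= (@idfun R)^\+ x <= `|x|.
  by rewrite funrpos_ge0 /funrpos /= ge_max ler_norm normr_ge0.
have neg0 (x : R) : 0 <= (@idfun R)^\- x <= `|x|.
  by rewrite funrneg_ge0 /funrneg /= ge_max -normrN ler_norm normr_ge0.
have mid := @measurable_id _ R setT.
have [pphi [pphiE pphi0 pE]] := meanE _ (measurable_funrpos mid) pos0.
have [nphi [nphiE nphi0 nE]] := meanE _ (measurable_funrneg mid) neg0.
have phiE i : phi i = pphi i - nphi i.
  apply: (has_mean_uniq _ _ _ _ (Fphi i)).
  by rewrite -(funrposBneg (F i)); apply: has_meanB; [exact: pphiE|exact: nphiE].
apply: (has_mean_uniq _ _ _ _ phim); rewrite m'E.
rewrite (_ : phi \o K = fun w => pphi (K w) - nphi (K w)); last first.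
  by apply/funext => w /=; rewrite phiE.
apply: has_meanB; apply: has_mean_ge0.
- exact: mkphi.
- by move=> w; have /andP[] := pphi0 (K w).
- by rewrite -pE Fp.2.
- exact: mkphi.
- by move=> w; have /andP[] := nphi0 (K w).
- by rewrite -nE Fn.2.
Qed.

End freezing.

(** * Partial sums *)

(** This counts the diagonal cells of an m by n rectangle. *)
Lemma sum_ltn_minn m n : (\sum_(i < m) (i < n) = minn m n)%N.
Proof.
elim: m => [|m IH]; first by rewrite big_ord0 min0n.
by rewrite big_ord_recr/= IH; case: ltnP; lia.
Qed.

Section partial_sums.
Context {d} {T : measurableType d} {R : realType} (P : probability T R).
Implicit Types (Z : nat -> T -> R) (m n : nat).

Lemma mutually_independent_pairwise (I : choiceType) (Z : I -> T -> R) i j :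
  mutually_independent P Z -> i != j -> independent_functions P (Z i) (Z j).
Proof.
move=> indZ ij A B mA mB.
have := indZ [fset i; j]%fset (fun k => if k == i then A else B).
rewrite big_fsetU1 ?inE//= big_seq_fset1 eqxx (eq_sym j) (negbTE ij).
rewrite (_ : bigcap _ _ = Z i @^-1` A `&` Z j @^-1` B); last first.
  apply/seteqP; split => w /=.
    move=> h; split; first by have := h i; rewrite eqxx; apply; rewrite /= !inE eqxx.
    have := h j; rewrite (eq_sym j) (negbTE ij); apply.
    by rewrite /= !inE eqxx orbT.
  move=> [wA wB] k /=; rewrite !inE => /orP[/eqP ->|/eqP ->].
    by rewrite eqxx.
  by rewrite (eq_sym j) (negbTE ij).
by apply=> k; case: ifP.
Qed.

Lemma has_mean_partial_sum Z z n : (forall i, has_mean P (Z i) z) ->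
  has_mean P (fun w => \sum_(i < n) Z i w) (n%:R * z).
Proof.
move=> Zz; rewrite (_ : n%:R * z = \sum_(i < n) z); last first.
  by rewrite sumr_const card_ord mulr_natl.
by apply: has_mean_sum => i; exact: Zz.
Qed.

Lemma has_mean_partial_sumM Z z1 z2 m n :
  (forall i, has_mean P (Z i) z1) ->
  (forall i, has_mean P (fun w => Z i w ^+ 2) z2) ->
  (forall i j, i != j -> independent_functions P (Z i) (Z j)) ->
  has_mean P (fun w => (\sum_(i < m) Z i w) * (\sum_(j < n) Z j w))
    ((minn m n)%:R * (z2 - z1 ^+ 2) + m%:R * n%:R * z1 ^+ 2).
Proof.
move=> Zz1 Zz2 indZ.
(* The mean of Z_i Z_j: [z1 ^+ 2] off the diagonal by independence, [z2] on it. *)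
pose c (i j : nat) : R := z1 ^+ 2 + (i == j)%:R * (z2 - z1 ^+ 2).
rewrite (_ : _ + _ = \sum_(i < m) \sum_(j < n) c i j); last first.
  rewrite /c; under eq_bigr do rewrite big_split/= sumr_const card_ord.
  rewrite big_split/= sumr_const card_ord addrC; congr (_ + _); last first.
    by rewrite -(mulr_natl (z1 ^+ 2 *+ n)) -(mulr_natl (z1 ^+ 2)) mulrA.
  under eq_bigr do rewrite -mulr_suml.
  rewrite -mulr_suml; congr (_ * _).
  under eq_bigr => i _.
    rewrite (_ : \sum_(j < n) _ = (i < n)%N%:R); last first.
      case: ltnP => [lt_in|le_ni].
        rewrite (bigD1 (Ordinal lt_in))//= eqxx big1 ?addr0// => j ji.
        rewrite (_ : (i == j :> nat) = false)//.
        by apply: contra_neqF ji => /eqP ij; exact/val_inj.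
      rewrite big1// => j _; rewrite (_ : (i == j :> nat) = false)//.
      by apply/negbTE; rewrite neq_ltn (leq_trans (ltn_ord j) le_ni) orbT.
    over.
  by rewrite -natr_sum sum_ltn_minn.
rewrite (_ : (fun w => _) = fun w => \sum_(i < m) \sum_(j < n) Z i w * Z j w).
  apply: has_mean_sum => i; apply: has_mean_sum => j.
  rewrite /c; case: eqVneq => [->|ij].
    rewrite mul1r addrC subrK (_ : (fun w => _) = fun w => Z j w ^+ 2)//.
  by rewrite mul0r addr0 expr2; apply: has_meanM => //; exact: indZ.
by apply/funext => w; rewrite big_distrlr.
Qed.

End partial_sums.

(** * Time changes sampled on a grid *)

Section grid.
Context {d} {T : measurableType d} {R : realType} (P : probability T R).
Variables (Z : R -> R -> T -> R) (phi : R -> R -> R) (U V : T -> R).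
Hypotheses (mU : measurable_fun setT U) (mV : measurable_fun setT V).
Hypotheses (U0 : forall w, 0 <= U w) (V0 : forall w, 0 <= V w).
Hypothesis Z0 : forall u v w, 0 <= u -> 0 <= v -> 0 <= Z u v w.
Hypothesis Zphi : forall u v, 0 <= u -> 0 <= v -> has_mean P (Z u v) (phi u v).
Hypothesis Zindep : forall u v (A B : set R), 0 <= u -> 0 <= v ->
  measurable A -> measurable B ->
  independent_of_event P (Z u v) (U @^-1` A `&` V @^-1` B).

(* The multiple of r just below x >= 0, shifted by e steps. *)
Definition grid (r : R) (e : nat) (x : R) : R := (Num.truncn (x / r) + e)%:R * r.

Lemma grid_ge0 r e x : 0 < r -> 0 <= grid r e x.
Proof. by move=> r0; rewrite mulr_ge0// ltW. Qed.

Lemma grid0_le r x : 0 < r -> 0 <= x -> grid r 0 x <= x.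
Proof.
move=> r0 x0; rewrite /grid addn0 -ler_pdivlMr//.
by have /andP[] := truncn_itv (divr_ge0 x0 (ltW r0)).
Qed.

Lemma le_grid1 r x : 0 < r -> 0 <= x -> x <= grid r 1 x.
Proof.
move=> r0 x0; rewrite /grid addn1 -ler_pdivrMr//.
by have /andP[_ /ltW] := truncn_itv (divr_ge0 x0 (ltW r0)).
Qed.

Lemma grid1 r x : grid r 1 x = grid r 0 x + r.
Proof. by rewrite /grid addn0 addn1 -natr1 mulrDl mul1r. Qed.

Let K r w := (Num.truncn (U w / r), Num.truncn (V w / r)).

(** For x >= 0 the truncation of x / r equals n exactly on the interval [n r, (n + 1) r[, so every
    fibre is a rectangle event to which [Zindep] applies. *)
Let mK r i : 0 < r -> exists A B, [/\ measurable A, measurable B &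
  K r @^-1` [set i] = U @^-1` A `&` V @^-1` B].
Proof.
move=> r0; exists `[i.1%:R * r, i.1.+1%:R * r[%classic.
exists `[i.2%:R * r, i.2.+1%:R * r[%classic; split => //.
have E (x : R) n : 0 <= x -> (Num.truncn (x / r) = n) <->
    (x \in `[n%:R * r, n.+1%:R * r[).
  move=> x0; rewrite in_itv/= -ler_pdivlMr// -ltr_pdivrMr//; split.
    by move=> <-; apply: truncn_itv; rewrite divr_ge0// ltW.
  exact: truncn_def.
case: i => i j; apply/seteqP; split => w /=.
  by rewrite /K => -[/E Ui /E Vj]; split; [exact: Ui|exact: Vj].
by move=> [/E Ui /E Vj]; rewrite /K Ui// Vj.
Qed.

Let mKr r i : 0 < r -> measurable (K r @^-1` [set i]).
Proof.
move=> r0; have [A [B [mA mB ->]]] := mK r i r0.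
by apply: measurableI; exact: measurable_preimage.
Qed.

Lemma measurable_grid r e : 0 < r ->
  measurable_fun setT (fun w => Z (grid r e (U w)) (grid r e (V w)) w).
Proof.
move=> r0; pose F (i : nat * nat) := Z ((i.1 + e)%:R * r) ((i.2 + e)%:R * r).
apply: (measurable_freeze (K r) (fun i => mKr r i r0) _ _ F) => i.
by apply: (has_mean_measurable P); apply: Zphi; rewrite mulr_ge0// ltW.
Qed.

Lemma measurable_grid_mean r e : 0 < r ->
  measurable_fun setT (fun w => phi (grid r e (U w)) (grid r e (V w))).
Proof.
move=> r0; pose F (i : nat * nat) (w : T) :=
  phi ((i.1 + e)%:R * r) ((i.2 + e)%:R * r).
apply: (measurable_freeze (K r) (fun i => mKr r i r0) _ _ F) => i.
exact: measurable_cst.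
Qed.

Lemma ge0_integral_grid r e : 0 < r ->
  (\int[P]_w (Z (grid r e (U w)) (grid r e (V w)) w)%:E =
   \int[P]_w (phi (grid r e (U w)) (grid r e (V w)))%:E)%E.
Proof.
move=> r0; pose F (i : nat * nat) := Z ((i.1 + e)%:R * r) ((i.2 + e)%:R * r).
pose f (i : nat * nat) := phi ((i.1 + e)%:R * r) ((i.2 + e)%:R * r).
have ge0 n : 0 <= (n + e)%:R * r by rewrite mulr_ge0// ltW.
apply: (ge0_integral_freeze P (K r) (fun i => mKr r i r0) F f).
- by move=> i w; exact: Z0.
- move=> i; have [A [B [mA mB ->]]] := mK r i r0.
  exact: Zindep.
- by move=> i; exact: Zphi.
Qed.

Hypothesis Zmono : forall u v u' v' w, 0 <= u -> 0 <= v -> u <= u' -> v <= v' ->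
  Z u v w <= Z u' v' w.
Variables (a b c m : R).
Hypotheses (Ua : has_mean P U a) (Vb : has_mean P V b).
Hypothesis phim : has_mean P (fun w => phi (U w) (V w)) m.
Hypothesis phi_inc : forall u v r, 0 <= u -> 0 <= v -> 0 <= r <= 1 ->
  phi (u + r) (v + r) <= phi u v + r * (c * (1 + u + v)).
Hypothesis c0 : 0 <= c.

(** By monotonicity the value at (U, V) lies between those at the grid points below and above, whose
    means are known by freezing. Both differ from [m] by at most [r * C], thanks to [phi_inc] and
    the integrability of U and V, and r tends to 0. Two time arguments are carried for the sake of
    joint moments. *)
Lemma has_mean_time_change : measurable_fun setT (fun w => Z (U w) (V w) w) ->
  has_mean P (fun w => Z (U w) (V w) w) m.
Proof.
move=> mZ.
have phi_mono u v u' v' : 0 <= u -> 0 <= v -> u <= u' -> v <= v' ->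
    phi u v <= phi u' v'.
  move=> u0 v0 uu' vv'.
  apply: (has_mean_le P (Z u v) (Z u' v') _ _ _ (Zphi _ _ u0 v0)).
    by move=> w; exact: Zmono.
  by apply: Zphi; [exact: le_trans uu'|exact: le_trans vv'].
have phi0 u v : 0 <= u -> 0 <= v -> 0 <= phi u v.
  move=> u0 v0; apply: (has_mean_le P (cst 0) (Z u v)).
  - by move=> w; exact: Z0.
  - exact: has_mean_cst.
  - exact: Zphi.
(* The mean of c (1 + U + V), hence r C bounds the mean gap between the two grid values. *)
pose C := c * (1 + a + b).
have errm r : has_mean P (fun w => r * (c * (1 + U w + V w))) (r * C).
  do 2 apply: has_meanZ; apply: has_meanD => //; apply: has_meanD => //.
  exact: has_mean_cst.
pose lo r w := phi (grid r 0 (U w)) (grid r 0 (V w)).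
pose hi r w := phi (grid r 1 (U w)) (grid r 1 (V w)).
have hi_lo r w : 0 < r <= 1 -> hi r w <= lo r w + r * (c * (1 + U w + V w)).
  move=> /andP[r0 r1]; rewrite /hi /lo !grid1.
  apply: le_trans (phi_inc _ _ _ _ _ _) _; rewrite ?grid_ge0// ?(ltW r0)//.
  rewrite lerD2l ler_pM2l//; apply: ler_wpM2l => //.
  by rewrite -!addrA lerD2l lerD//; exact: grid0_le.
have W0 w : 0 <= Z (U w) (V w) w by exact: Z0.
have upper r : 0 < r <= 1 ->
    (\int[P]_w (Z (U w) (V w) w)%:E <= (m + r * C)%:E)%E.
  move=> r01; have /andP[r0 r1] := r01.
  apply: (@le_trans _ _ (\int[P]_w (Z (grid r 1 (U w)) (grid r 1 (V w)) w)%:E)%E).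
    apply: ge0_le_integral => //.
    - by move=> w _; rewrite lee_fin.
    - exact/measurable_EFinP.
    - by apply/measurable_EFinP; exact: measurable_grid.
    - by move=> w _; rewrite lee_fin; apply: Zmono => //; exact: le_grid1.
  rewrite ge0_integral_grid//.
  have phierr : has_mean P (fun w => phi (U w) (V w) + r * (c * (1 + U w + V w)))
      (m + r * C) by exact: has_meanD.
  have [_ <-] := phierr; apply: ge0_le_integral => //.
  - by move=> w _; rewrite lee_fin phi0// grid_ge0.
  - by apply/measurable_EFinP; exact: measurable_grid_mean.
  - by apply/measurable_EFinP; exact: has_mean_measurable phierr.
  - move=> w _; rewrite lee_fin (le_trans (hi_lo r w r01))// lerD2r.
    by apply: phi_mono; rewrite ?grid_ge0//; exact: grid0_le.
have [m' Wm'] : exists m', has_mean P (fun w => Z (U w) (V w) w) m'.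
  apply: has_mean_lty => //; apply: le_lt_trans (upper 1 _) (ltry _).
  by rewrite ltr01 lexx.
have upper' r : 0 < r <= 1 -> m' <= m + r * C.
  by move=> /upper; rewrite Wm'.2 lee_fin.
(* Here phi(U, V) <= [hi] <= [lo] + error, and the mean of [lo] equals that of Z at the lower grid
   point, which is at most m'. *)
have lower r : 0 < r <= 1 -> m <= m' + r * C.
  move=> r01; have /andP[r0 r1] := r01.
  have Zlo w : Z (grid r 0 (U w)) (grid r 0 (V w)) w <= Z (U w) (V w) w.
    by apply: Zmono; rewrite ?grid_ge0//; exact: grid0_le.
  have [l Zl] : exists l,
      has_mean P (fun w => Z (grid r 0 (U w)) (grid r 0 (V w)) w) l.
    apply: (has_mean_dominated _ _ _ _ _ _ Wm'); first exact: measurable_grid.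
    by move=> w; rewrite ger0_norm// Z0// grid_ge0.
  have lol : has_mean P (lo r) l.
    apply: has_mean_ge0.
    - exact: measurable_grid_mean.
    - by move=> w; rewrite phi0// grid_ge0.
    - by rewrite -ge0_integral_grid// Zl.2.
  have lm' : l <= m' by exact: has_mean_le Zl Wm'.
  apply: (@le_trans _ _ (l + r * C)); last by rewrite lerD2r.
  apply: (has_mean_le _ _ _ _ _ _ phim (has_meanD _ _ _ _ _ lol (errm r))) => w.
  apply: le_trans (hi_lo r w r01).
  by apply: phi_mono => //; exact: le_grid1.
suff -> : m = m' by [].
have C0 : 0 <= C.
  have a0 : 0 <= a by exact: has_mean_le U0 (has_mean_cst P 0) Ua.
  have b0 : 0 <= b by exact: has_mean_le V0 (has_mean_cst P 0) Vb.
  by rewrite mulr_ge0// !addr_ge0.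
have small (x y : R) : (forall r, 0 < r <= 1 -> x <= y + r * C) -> x <= y.
  move=> xy; apply/ler_addgt0Pr => e e0.
  (* The summand 1 in the denominator covers the case C = 0. *)
  pose r := Num.min 1 (e / (C + 1)).
  have C1 : 0 < C + 1 by rewrite ltr_wpDl.
  have r0 : 0 < r by rewrite lt_min ltr01 divr_gt0.
  have r1 : r <= 1 by rewrite ge_min lexx.
  apply: le_trans (xy r _) _; first by rewrite r0.
  rewrite lerD2l; apply: (@le_trans _ _ (r * (C + 1))).
    by rewrite ler_pM2l// lerDl.
  by rewrite -ler_pdivlMr// /r ge_min lexx orbT.
by apply/eqP; rewrite eq_le !small.
Qed.

End grid.

(** * Poisson and mixed Poisson processes *)

(** Terms with k < j vanish; in the others the falling factorial cancels against k!, and shifting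
    the index by j leaves a^j times the total mass 1. *)
Lemma poisson_factorial_moment (R : realType) (a : R) (j : nat) : 0 < a ->
  (\sum_(k <oo) ((k ^_ j)%:R * poisson_pmf a k)%:E = (a ^+ j)%:E)%E.
Proof.
move=> a0; have pmf0 k : 0 <= poisson_pmf a k by exact: poisson_pmf_ge0.
rewrite (nneseries_split _ j); last by move=> k _; rewrite lee_fin mulr_ge0.
rewrite add0n [X in (X + _)%E]big1_seq ?add0e; last first.
  move=> k; rewrite mem_index_iota => /andP[_ kj].
  by rewrite ffact_small// mul0r.
rewrite -nneseries_addn; last by move=> k; rewrite lee_fin mulr_ge0.
have shift k : ((k + j)%N ^_ j)%:R * poisson_pmf a (k + j)%N =
    a ^+ j * poisson_pmf a k.
  have kf0 : (k`!%:R : R) != 0 by rewrite pnatr_eq0 -lt0n fact_gt0.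
  have kjf0 : ((k + j)`!%:R : R) != 0 by rewrite pnatr_eq0 -lt0n fact_gt0.
  have -> : ((k + j)%N ^_ j)%:R = ((k + j)`!)%:R / k`!%:R :> R.
    by rewrite -(ffact_fact (leq_addl k j)) addnK natrM mulfK.
  by rewrite /poisson_pmf a0 exprD; field; rewrite kf0.
under eq_eseriesr do rewrite shift EFinM.
rewrite nneseriesZl//; last by move=> k _; exact: pmf0.
rewrite nneseries_esumT; last by move=> k; exact: pmf0.
rewrite (_ : esum _ _ = 1)%E ?mule1//.
by rewrite -(@probability_setT _ _ _ (poisson_prob a 0)) /= /poisson_prob a0.
Qed.

Section mixed_poisson.
Context {d} {T : measurableType d} {R : realType} (P : probability T R).

Lemma ge0_integral_nat (A : T -> nat) (g : nat -> R) :
  (forall k, measurable (A @^-1` [set k])) -> (forall k, 0 <= g k) ->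
  (\int[P]_w (g (A w))%:E = \sum_(k <oo) (g k)%:E * P (A @^-1` [set k]))%E.
Proof.
move=> mA g0.
have AT : \bigcup_k A @^-1` [set k] = setT.
  by apply/seteqP; split => // w _; exists (A w).
rewrite -AT ge0_integral_bigcup//; last 3 first.
- rewrite AT; apply/measurable_EFinP.
  by apply: (measurable_freeze A mA _ _ (fun i _ => g i)).
- by move=> w _; rewrite lee_fin.
- by move=> n m _ _ [w [/= <- <-]].
apply: eq_eseriesr => k _.
transitivity (\int[P]_(w in A @^-1` [set k]) (cst (g k)%:E w))%E.
  by apply: eq_integral => w; rewrite inE /= => ->.
by rewrite integral_cst.
Qed.

(* poisson_pmf is 1 at rates <= 0, so that L has to be positive. *)
Lemma mixed_poisson_factorial_moment (A : T -> nat) (L : T -> R) (c l : R) j :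
  (forall k, measurable (A @^-1` [set k])) -> measurable_fun setT L ->
  {ae P, forall w, 0 < L w} -> 0 < c ->
  (forall k, P (A @^-1` [set k]) = \int[P]_w (poisson_pmf (L w * c) k)%:E)%E ->
  has_mean P (fun w => L w ^+ j) l ->
  has_mean P (fun w => (A w ^_ j)%:R) (c ^+ j * l).
Proof.
move=> mA mL L0 c0 lawA Ll.
have mpmf k : measurable_fun setT (fun w => poisson_pmf (L w * c) k).
  apply: (measurableT_comp (measurable_poisson_pmf k measurableT)).
  exact: measurable_funM.
apply: has_mean_ge0 => //.
  by apply: (measurable_freeze A mA _ _ (fun i _ => (i ^_ j)%:R : R)).
rewrite (ge0_integral_nat A (fun k => (k ^_ j)%:R))//.
(* Exchanging sum and integral turns the inner sum into the Poisson factorial moment (c L)^j, almost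
   everywhere. *)
transitivity (\sum_(k <oo) \int[P]_w ((k ^_ j)%:R * poisson_pmf (L w * c) k)%:E)%E.
  apply: eq_eseriesr => k _; rewrite lawA -ge0_integralZl_EFin//.
    by move=> w _; rewrite lee_fin poisson_pmf_ge0.
  exact/measurable_EFinP.
rewrite -integral_nneseries//; last 2 first.
- by move=> k; apply/measurable_EFinP; exact: measurable_funM.
- by move=> k w _; rewrite lee_fin mulr_ge0// poisson_pmf_ge0.
have cLl : has_mean P (fun w => c ^+ j * L w ^+ j) (c ^+ j * l) by exact: has_meanZ.
have [_ <-] := cLl.
apply: ae_eq_integral => //.
- apply: ge0_emeasurable_sum.
    by move=> k w _ _; rewrite lee_fin mulr_ge0// poisson_pmf_ge0.
  by move=> k _; apply/measurable_EFinP; exact: measurable_funM.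
- by apply/measurable_EFinP; exact: has_mean_measurable cLl.
apply: filterS L0 => w Lw _.
by rewrite poisson_factorial_moment ?mulr_gt0// exprMn mulrC.
Qed.

Variables (C : R -> T -> nat) (L : T -> R) (l1 l2 : R).
Hypothesis mC : forall t k, measurable (C t @^-1` [set k]).
Hypothesis C0 : forall w, C 0 w = 0%N.
Hypothesis Cmono : forall w s t, 0 <= s -> s <= t -> (C s w <= C t w)%N.
Hypothesis mL : measurable_fun setT L.
Hypothesis L0 : {ae P, forall w, 0 < L w}.
Hypothesis lawC : forall s t k, 0 <= s -> s < t ->
  P [set w | C t w = (C s w + k)%N] =
  (\int[P]_w (poisson_pmf (L w * (t - s)) k)%:E)%E.
Hypotheses (Ll1 : has_mean P L l1) (Ll2 : has_mean P (fun w => L w ^+ 2) l2).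

Let incE s t k : 0 <= s -> s <= t ->
  (fun w => (C t w - C s w)%N) @^-1` [set k] = [set w | C t w = (C s w + k)%N].
Proof.
move=> s0 st; apply/seteqP; split => w /=; have := Cmono w s t s0 st; lia.
Qed.

Let minc s t k : 0 <= s -> s <= t ->
  measurable ((fun w => (C t w - C s w)%N) @^-1` [set k]).
Proof.
move=> s0 st; rewrite incE//.
rewrite (_ : [set w | _] =
    \bigcup_j (C s @^-1` [set j] `&` C t @^-1` [set (j + k)%N])).
  by apply: bigcupT_measurable => j; exact: measurableI.
apply/seteqP; split => w /=; first by exists (C s w).
by move=> [j _ [/= -> ->]].
Qed.

(** The factorial moments of orders 1 and 2 suffice, since x^2 = x + x (x - 1). A constant [L] gives
    the Poisson process, an exponential one the geometric counting process. *)
Lemma mixed_poisson_increment_moments s t : 0 <= s -> s <= t ->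
  has_mean P (fun w => (C t w - C s w)%:R) ((t - s) * l1) /\
  has_mean P (fun w => (C t w - C s w)%:R ^+ 2)
    ((t - s) * l1 + (t - s) ^+ 2 * l2).
Proof.
move=> s0; rewrite le_eqVlt => /orP[/eqP <-|st].
  rewrite subrr expr0n/= !mul0r addr0.
  under eq_fun do rewrite subnn; under [in X in _ /\ X]eq_fun do rewrite subnn expr0n.
  by split; exact: has_mean_cst.
have ts0 : 0 < t - s by rewrite subr_gt0.
have mom j l : has_mean P (fun w => L w ^+ j) l ->
    has_mean P (fun w => ((C t w - C s w)%N ^_ j)%:R) ((t - s) ^+ j * l).
  apply: mixed_poisson_factorial_moment => //.
    by move=> k; apply: minc => //; exact: ltW.
  by move=> k; rewrite incE ?(ltW st)//; exact: lawC.
have M1 : has_mean P (fun w => (C t w - C s w)%:R) ((t - s) * l1).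
  have := mom 1%N l1 Ll1; rewrite expr1; congr (has_mean _ _ _).
  by apply/funext => w; rewrite ffactn1.
split => //; have := has_meanD _ _ _ _ _ M1 (mom 2%N l2 Ll2).
congr (has_mean _ _ _); apply/funext => w.
by rewrite -natrD -natrX ffactnS ffactn1; congr (_%:R); nia.
Qed.

Lemma mixed_poisson_mean t : 0 <= t ->
  has_mean P (fun w => (C t w)%:R) (t * l1).
Proof.
move=> t0; have [+ _] := mixed_poisson_increment_moments 0 t (lexx 0) t0.
by rewrite subr0; under eq_fun do rewrite C0 subn0.
Qed.

(* Polarization: 2 C_s C_t = C_s ^ 2 + C_t ^ 2 - (C_t - C_s) ^ 2. *)
Lemma mixed_poisson_meanM s t : 0 <= s -> 0 <= t ->
  has_mean P (fun w => (C s w)%:R * (C t w)%:R)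
    (Num.min s t * l1 + s * t * l2).
Proof.
wlog st : s t / s <= t.
  move=> H s0 t0; have /orP[st|ts] := le_total s t; first exact: H.
  have := H t s ts t0 s0; rewrite minC (mulrC t s).
  by under eq_fun do rewrite mulrC.
move=> s0 t0; rewrite minEle st.
have [_ Ms] := mixed_poisson_increment_moments 0 s (lexx 0) s0.
have [_ Mt] := mixed_poisson_increment_moments 0 t (lexx 0) t0.
have [_ Mst] := mixed_poisson_increment_moments s t s0 st.
have := has_meanZ _ 2^-1 _ _ (has_meanB _ _ _ _ _ (has_meanD _ _ _ _ _ Ms Mt) Mst).
congr (has_mean _ _ _); last by field.
by apply/funext => w; rewrite C0 !subn0 natrB ?Cmono//; field.
Qed.

End mixed_poisson.

(** * Moments of the exponential law *)

Section exponential_moments.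
Context {R : realType}.
Notation leb := (@lebesgue_measure R).

(** The Radon-Nikodym derivative of Q and the given density [p] have the same integral over every
    measurable set, so they agree almost everywhere. *)
Lemma ge0_integral_density (Q : probability (measurableTypeR R) R)
    (p f : measurableTypeR R -> R) :
  measurable_fun setT p -> (forall x, 0 <= p x) ->
  (forall B, measurable B -> Q B = \int[leb]_(x in B) (p x)%:E)%E ->
  measurable_fun setT f -> (forall x, 0 <= f x) ->
  (\int[Q]_x (f x)%:E = \int[leb]_x (f x * p x)%:E)%E.
Proof.
move=> mp p0 Qp mf f0.
have mEp : measurable_fun setT (EFin \o p) by exact/measurable_EFinP.
have mEf : measurable_fun setT (EFin \o f) by exact/measurable_EFinP.
have dom : Q `<< leb.
  apply/null_content_dominatesP => A mA A0; rewrite -[LHS]/(Q A) Qp//.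
  by apply: null_set_integral => //; exact: measurable_funTS.
rewrite -(Radon_Nikodym_SigmaFinite.change_of_variables dom)//.
have := @measurable_int _ _ _ _ _ _ (Radon_Nikodym_SigmaFinite.f_integrable dom) => mRN.
apply: ae_eq_integral => //.
- exact: emeasurable_funM.
- by apply/measurable_EFinP; exact: measurable_funM.
under [X in ae_eq _ _ _ X]eq_fun do rewrite EFinM.
apply: ae_eqe_mul2l; apply: integral_ae_eq => //.
  exact: Radon_Nikodym_SigmaFinite.f_integrable.
by move=> A _ mA; rewrite -Radon_Nikodym_SigmaFinite.f_integral//; exact: Qp.
Qed.

(** For x >= 1 the polynomial is at most (|a1| + |a2| + |a3|) x^2, while exp(c x) >= (c x)^3 / 3!;
    the product is thus at most [M / x]. *)
Lemma cvg_quadratic_expR (c a1 a2 a3 : R) : 0 < c ->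
  (a1 * x ^+ 2 + a2 * x + a3) * expR (- (c * x)) @[x --> +oo] --> 0.
Proof.
move=> c0; pose M := (`|a1| + `|a2| + `|a3|) * (6 / c ^+ 3).
have M0 : 0 <= M by rewrite mulr_ge0// ?addr_ge0// divr_ge0// exprn_ge0// ltW.
apply/cvgrPdist_le => e e0; near=> x.
have x1 : 1 <= x by near: x; apply: nbhs_pinfty_ge; rewrite num_real.
have xM : M / e <= x by near: x; apply: nbhs_pinfty_ge; rewrite num_real.
have x0 : 0 < x by exact: lt_le_trans x1.
have cx0 : 0 <= c * x by rewrite mulr_ge0// ltW.
rewrite sub0r normrN normrM (ger0_norm (expR_ge0 _)).
have expx : expR (- (c * x)) <= 6 / (c * x) ^+ 3.
  rewrite expRN -[leRHS]invrK lef_pV2 ?posrE ?expR_gt0//; last first.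
    by rewrite invr_gt0 divr_gt0 ?exprn_gt0 ?mulr_gt0.
  rewrite invf_div; have := expR_ge1Dxn 2 cx0.
  by rewrite (_ : 3`!%:R = 6 :> R)//; lra.
apply: (@le_trans _ _ (((`|a1| + `|a2| + `|a3|) * x ^+ 2) * (6 / (c * x) ^+ 3))).
  apply: ler_pM => //; rewrite ?expR_ge0//.
  apply: le_trans (ler_normD _ _) _; rewrite !mulrDl; apply: lerD; last first.
    by rewrite ler_peMr// exprn_ege1.
  apply: le_trans (ler_normD _ _) _; apply: lerD.
    by rewrite normrM (ger0_norm (exprn_ge0 _ (ltW x0))).
  rewrite normrM (ger0_norm (ltW x0)) ler_wpM2l// expr2 ler_peMr// ltW//.
rewrite (_ : _ * _ = M / x); last first.
  by rewrite /M; field; rewrite !gt_eqF.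
by rewrite ler_pdivrMr// mulrC -ler_pdivrMr.
Unshelve. all: by end_near. Qed.

(** With q the quadratic polynomial, the integrand is the derivative of -q(x) exp(-c x), which goes
    from -a3 at 0 to 0 at infinity. Moments of the exponential law follow by solving c q - q' = c
    x^j for q. *)
Lemma integral_quadratic_expR (c a1 a2 a3 : R) : 0 < c ->
  (forall x, 0 <= x ->
     0 <= c * (a1 * x ^+ 2 + a2 * x + a3) - (2 * a1 * x + a2)) ->
  (\int[leb]_(x in `[0%R, +oo[)
     ((c * (a1 * x ^+ 2 + a2 * x + a3) - (2 * a1 * x + a2)) *
      expR (- (c * x)))%:E = a3%:E)%E.
Proof.
move=> c0 f0.
pose q (x : R) := a1 * x ^+ 2 + a2 * x + a3.
pose F (x : R) := - (q x * expR (- (c * x))).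
have dF (x : R) : is_derive x 1 F ((c * q x - (2 * a1 * x + a2)) * expR (- (c * x))).
  rewrite /F /q; apply: is_derive_eq.
  rewrite /GRing.scale/=.
  ring.
have cF (x : R) : {for x, continuous F}.
  by apply: differentiable_continuous; apply/derivable1_diffP; exact: ex_derive.
rewrite (@ge0_continuous_FTC2y _ _ F 0 0).
- by rewrite -EFinB /F /q expr0n/= !mulr0 oppr0 expR0 !add0r mulr1 opprK.
- by move=> x x0; rewrite mulr_ge0 ?expR_ge0// f0.
- apply: continuous_subspaceT => x.
  apply: differentiable_continuous; apply/derivable1_diffP; exact: ex_derive.
- rewrite -[0 in X in _ --> X]oppr0; apply: cvgN; exact: cvg_quadratic_expR.
- by move=> x _; exact: ex_derive.
- by apply: cvg_at_right_filter; exact: cF.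
- by move=> x _; rewrite derive1E; exact: derive_val.
Qed.

End exponential_moments.

Section exponential_variable.
Context {d} {T : measurableType d} {R : realType} (P : probability T R).
Notation leb := (@lebesgue_measure R).
Variables (L : {RV P >-> R}) (mu : R).
Hypothesis mu0 : 0 < mu.
Hypothesis lawL : forall B : set R, measurable B ->
  distribution P L B = exponential_prob mu^-1 B.

Let c := mu^-1.
Let c0 : 0 < c. Proof. by rewrite invr_gt0. Qed.

Lemma exponential_gt0 : {ae P, forall w, 0 < L w}.
Proof.
exists (L @^-1` `]-oo, 0]%classic); split.
- exact: measurable_preimage.
- transitivity (exponential_prob c `]-oo, 0]%classic); first exact: lawL.
  (* The density vanishes only on the open negative half-line; the point 0 is discarded as a null
     set. *)
  rewrite /exponential_prob -integral_itv_bndo_bndc; last first.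
    apply/measurable_EFinP; apply: measurable_funTS.
    exact: measurable_exponential_pdf.
  apply: integral0_eq => x; rewrite /= in_itv/= => x0.
  by rewrite lt0_exponential_pdf.
- by move=> w /= /negP; rewrite -leNgt in_itv.
Qed.

Lemma ge0_exponential_mean (f : R -> R) :
  measurable_fun setT f -> (forall x, 0 <= f x) ->
  (\int[P]_w (f (L w))%:E =
   \int[leb]_(x in `[0%R, +oo[) (f x * (c * expR (- (c * x))))%:E)%E.
Proof.
move=> mf f0.
pose L' : {RV P >-> measurableTypeR R} := HB.pack (L : T -> measurableTypeR R)
  (isMeasurableFun.Build _ _ _ _ (L : T -> measurableTypeR R)
     (measurable_funP L)).
transitivity (\int[distribution P L']_x (f x)%:E)%E.
  by rewrite ge0_integral_distribution//; exact/measurable_EFinP.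
rewrite (ge0_integral_density _ (exponential_pdf c))//.
- rewrite [RHS]integral_mkcond; apply: eq_integral => x _.
  rewrite /exponential_pdf !patchE; case: ifPn => // _.
    by rewrite mulNr.
  by rewrite mulr0.
- exact: measurable_exponential_pdf.
- by move=> x; apply: exponential_pdf_ge0; exact: ltW.
Qed.

Lemma exponential_mean : has_mean P L mu.
Proof.
(* The density formula is for nonnegative functions, so |L| comes first; it equals L almost
   surely. *)
have absL : has_mean P (fun w => `|L w|) mu.
  apply: has_mean_ge0 => //; first exact: measurableT_comp.
  rewrite (ge0_exponential_mean (fun x => `|x|))//.
  (* With c = 1 / mu, the polynomial q = x + mu satisfies c q - q' = c x. *)
  rewrite -(@integral_quadratic_expR _ c 0 1 mu)//; last first.
    move=> x x0; rewrite mul0r add0r mul1r mulr0 mul0r add0r mulrDr mulVf ?gt_eqF//.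
    by rewrite addrK mulr_ge0// ltW.
  apply: eq_integral => x; rewrite inE/= in_itv/= andbT => x0.
  rewrite ger0_norm//; congr EFin.
  by rewrite /c; field; rewrite gt_eqF.
have [absLi absLm] := absL; split.
  by apply: (le_integrable _ _ _ absLi) => //; [exact/measurable_EFinP|
    move=> w _ /=; rewrite lee_fin normr_id].
rewrite -absLm; apply: ae_eq_integral => //.
- exact/measurable_EFinP.
- by apply/measurable_EFinP; exact: measurableT_comp.
by apply: filterS exponential_gt0 => w Lw _; rewrite gtr0_norm.
Qed.

Lemma exponential_second_moment : has_mean P (fun w => L w ^+ 2) (2 * mu ^+ 2).
Proof.
apply: has_mean_ge0.
- exact: measurable_funX.
- by move=> w; exact: sqr_ge0.
rewrite (ge0_exponential_mean (fun x => x ^+ 2))//; last by move=> x; exact: sqr_ge0.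
(* Here q = x^2 + 2 mu x + 2 mu^2 satisfies c q - q' = c x^2. *)
rewrite -(@integral_quadratic_expR _ c 1 (2 * mu) (2 * mu ^+ 2))//; last first.
  move=> x x0; rewrite (_ : _ - _ = c * x ^+ 2).
    by rewrite mulr_ge0 ?sqr_ge0// ltW.
  by rewrite /c; field; rewrite gt_eqF.
apply: eq_integral => x _; congr EFin.
by rewrite /c; field; rewrite gt_eqF.
Qed.

End exponential_variable.

(** * Random indices *)

Section random_index.
Context {d} {T : measurableType d} {R : realType} (P : probability T R).
Variables (W : nat -> T -> R) (alpha p q : R) (M N : T -> nat).
Hypotheses (mM : forall k, measurable (M @^-1` [set k]))
  (mN : forall k, measurable (N @^-1` [set k])).
Hypothesis W1 : forall m, has_mean P (W m) (m%:R * alpha).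
Hypothesis W2 : forall m n, has_mean P (fun w => W m w * W n w)
  ((minn m n)%:R * p + m%:R * n%:R * q).
Variables (m1 m2 n1 n2 a b : R).
Hypotheses (M1 : has_mean P (fun w => (M w)%:R) m1)
  (M2 : has_mean P (fun w => (M w)%:R ^+ 2) m2)
  (N1 : has_mean P (fun w => (N w)%:R) n1)
  (N2 : has_mean P (fun w => (N w)%:R ^+ 2) n2).

Let Wsq m : has_mean P (fun w => W m w ^+ 2) (m%:R * p + m%:R ^+ 2 * q).
Proof. by have := W2 m m; rewrite minnn. Qed.

(** Freezing at M, with |W_m| <= (1 + W_m^2) / 2 as the bound; its mean [psi m] is quadratic in m,
    hence integrable at M by [M1] and [M2]. *)
Lemma random_index_mean :
  (forall m, independent_of_event P (W m) (M @^-1` [set m])) ->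
  has_mean P (fun w => W (M w) w) (m1 * alpha).
Proof.
move=> indW; pose psi m := 2^-1 * (1 + (m%:R * p + m%:R ^+ 2 * q)).
apply: (has_mean_freeze P M mM W (fun m => m%:R * alpha) psi _
  (2^-1 * (1 + (m1 * p + m2 * q)))) => //.
- move=> m; exists (fun w => 2^-1 * (1 + W m w ^+ 2)).
    by apply: has_meanZ; apply: has_meanD => //; exact: has_mean_cst.
  move=> w; have := sqr_ge0 (`|W m w| - 1); rewrite -(real_normK (num_real (W m w))).
  by lra.
- rewrite /psi /=; apply: has_meanZ; apply: has_meanD; first exact: has_mean_cst.
  by apply: has_meanD => /=;
    under eq_fun do rewrite mulrC; rewrite mulrC; exact: has_meanZ.
- by rewrite /=; under eq_fun do rewrite mulrC; rewrite mulrC; exact: has_meanZ.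
Qed.

Hypotheses (MNmin : has_mean P (fun w => (minn (M w) (N w))%:R) a)
  (MN : has_mean P (fun w => (M w)%:R * (N w)%:R) b).

(** Freezing at the pair (M, N), with |W_m W_n| <= (W_m^2 + W_n^2) / 2 as the bound. *)
Lemma random_index_meanM :
  (forall m n, independent_of_event P (fun w => W m w * W n w)
     (M @^-1` [set m] `&` N @^-1` [set n])) ->
  has_mean P (fun w => W (M w) w * W (N w) w) (a * p + b * q).
Proof.
move=> indW; pose K w := (M w, N w).
have KE i : K @^-1` [set i] = M @^-1` [set i.1] `&` N @^-1` [set i.2].
  by case: i => m n; apply/seteqP; split => w; rewrite /K /= => -[Mw Nw];
    rewrite ?Mw ?Nw.
have mK i : measurable (K @^-1` [set i]) by rewrite KE; exact: measurableI.
pose F (i : nat * nat) w := W i.1 w * W i.2 w.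
pose phi (i : nat * nat) := (minn i.1 i.2)%:R * p + i.1%:R * i.2%:R * q.
pose psi (i : nat * nat) := 2^-1 * ((i.1%:R * p + i.1%:R ^+ 2 * q) +
  (i.2%:R * p + i.2%:R ^+ 2 * q)).
apply: (has_mean_freeze P K mK F phi psi _
  (2^-1 * ((m1 * p + m2 * q) + (n1 * p + n2 * q)))).
- by move=> i; rewrite KE; exact: indW.
- by move=> i; exact: W2.
- move=> i; exists (fun w => 2^-1 * (W i.1 w ^+ 2 + W i.2 w ^+ 2)).
    by apply: has_meanZ; exact: has_meanD.
  move=> w; rewrite /F normrM; have := sqr_ge0 (`|W i.1 w| - `|W i.2 w|).
  by rewrite -(real_normK (num_real (W i.1 w))) -(real_normK (num_real (W i.2 w))); lra.
- rewrite /psi /=; apply: has_meanZ.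
  by do !apply: has_meanD => /=;
    under eq_fun do rewrite mulrC; rewrite mulrC; exact: has_meanZ.
- by apply: has_meanD => /=;
    under eq_fun do rewrite mulrC; rewrite mulrC; exact: has_meanZ.
Qed.

End random_index.

(** * The sigma-algebra generated by a process *)

Section process_sigma_algebra.
Context {d d'} {T : measurableType d} {U : measurableType d'} {I : Type}.
Variables (A : set I) (Z : I -> T -> U).

Let G := \bigcup_(i in A) [set C | exists2 B, measurable B & C = Z i @^-1` B].

(** The sample space with the coarser sigma-algebra of the process: an event belongs to
    [process_sigma] as soon as it is the preimage of a measurable set under a function measurable on
    this type. *)
Definition process_sigmaType := g_sigma_algebraType G.
HB.instance Definition _ := Measurable.on process_sigmaType.

Lemma measurable_process i : A i ->
  measurable_fun setT (Z i : process_sigmaType -> U).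
Proof.
move=> Ai _ B mB; rewrite setTI; apply: sub_sigma_algebra.
by exists i => //; exists B.
Qed.

Lemma process_sigma_preimage d2 (V : measurableType d2)
    (f : process_sigmaType -> V) (B : set V) :
  measurable_fun setT f -> measurable B -> process_sigma A Z (f @^-1` B).
Proof. by move=> mf mB; exact: (measurable_preimage _ _ process_sigmaType). Qed.

Lemma process_sigmaI (B C : set T) :
  process_sigma A Z B -> process_sigma A Z C -> process_sigma A Z (B `&` C).
Proof. exact: (@measurableI _ process_sigmaType). Qed.

End process_sigma_algebra.

(** * Measurability of a counting process at a random time *)

Section time_change.
Context {d} {T : measurableType d} {R : realType}.

Lemma measurable_time_change (C : R -> T -> nat) (U : T -> R) :
  (forall t k, measurable (C t @^-1` [set k])) ->
  (forall w s t, 0 <= s -> s <= t -> (C s w <= C t w)%N) ->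
  (forall w t, 0 <= t -> (C u w)%:R @[u --> t^'+] --> ((C t w)%:R : R)) ->
  measurable_fun setT U -> (forall w, 0 <= U w) ->
  forall k, measurable ((fun w => C (U w) w) @^-1` [set k]).
Proof.
move=> mC Cmono Crc mU U0.
(* C (U w) w <= n iff C q w <= n for some rational q > U w *)
have mle n : measurable [set w | (C (U w) w <= n)%N].
  rewrite (_ : [set w | _] = \bigcup_(q : rat) (U @^-1` `]-oo, ratr q[%classic `&`
      \bigcup_(j in `I_n.+1) C (ratr q) @^-1` [set j])).
    apply: bigcupT_measurable_rat => q; apply: measurableI.
      exact: measurable_preimage.
    by apply: bigcup_measurable => j _.
  apply/seteqP; split => w /=.
    move=> Cn.
    (* Integers at distance less than 1 coincide, so right-continuity makes C constant just after U
       w. *)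
    have /cvgrPdist_lt/(_ 1 ltr01) near_eq := Crc w (U w) (U0 w).
    have [u [Uu Cu]] := filter_ex (filterI (nbhs_right_gt (U w)) near_eq).
    have [q] := rat_in_itvoo Uu; rewrite in_itv/= => /andP[Uq qu].
    exists q => //; split; first by rewrite /= in_itv.
    exists (C (ratr q) w) => //=.
    have Cqu := Cmono w _ _ (le_trans (U0 w) (ltW Uq)) (ltW qu).
    have CUu := Cmono w _ _ (U0 w) (ltW Uu).
    rewrite ltnS; apply: leq_trans Cqu _; apply: leq_trans Cn.
    move: Cu; rewrite /= distrC ger0_norm ?subr_ge0 ?ler_nat// -natrB//.
    by rewrite ltrn1; lia.
  move=> [q _ [/= ]]; rewrite in_itv/= => Uq [j /= jn Cj].
  by rewrite -ltnS (leq_ltn_trans (Cmono w _ _ (U0 w) (ltW Uq)))// Cj.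
move=> [|k].
  rewrite (_ : _ @^-1` _ = [set w | (C (U w) w <= 0)%N])//.
  by apply/seteqP; split => w /=; lia.
rewrite (_ : _ @^-1` _ = [set w | (C (U w) w <= k.+1)%N] `\`
   [set w | (C (U w) w <= k)%N]); first exact: measurableD.
by apply/seteqP; split => w /=; lia.
Qed.

End time_change.

(** * Levy and subordinated Poisson processes *)

Section measurable_nat.
Context {d} {T : measurableType d}.

Lemma measurable_nat_preimage (M : T -> nat) :
  measurable_fun setT M -> forall k, measurable (M @^-1` [set k]).
Proof. by move=> mM k; exact: measurable_preimage. Qed.

Lemma measurable_fun_of_nat (R : realType) (M : T -> nat) (g : nat -> R) :
  (forall k, measurable (M @^-1` [set k])) ->
  measurable_fun setT (fun w => g (M w)).
Proof. by move=> mM; apply: (measurable_freeze M mM _ _ (fun k _ => g k)). Qed.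

End measurable_nat.

Section levy_moments.
Context {d} {T : measurableType d} {R : realType} (P : probability T R).
Variables (D : R -> {RV P >-> R}) (d1 d2 : R).
Hypothesis levyD : levy_process D.
Hypotheses (D1 : has_mean P (D 1) d1) (D2 : has_mean P (fun w => D 1 w ^+ 2) d2).

Let inc (i : nat) w := D i.+1%:R w - D i%:R w.

Let sum_inc n w : \sum_(i < n) inc i w = D n%:R w.
Proof.
elim: n => [|n IH]; first by rewrite big_ord0 (levy_start levyD).
by rewrite big_ord_recr/= IH /inc addrC subrK.
Qed.

Let same_law_inc i : same_law P (D 1) (inc i).
Proof.
move=> B mB; have := levy_stat levyD (ler0n R i) ler01 mB.
rewrite natr1 => incE; apply/esym; apply: (etrans incE).
by congr (P _); apply/funext => w /=; rewrite (levy_start levyD) subr0.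
Qed.

Let has_mean_inc (h : R -> R) m i : measurable_fun setT h ->
  has_mean P (h \o D 1) m -> has_mean P (h \o inc i) m.
Proof.
move=> mh; apply: has_mean_same_law => //.
by apply: measurable_funB => //; exact: measurable_funP.
Qed.

Let indep_inc i j : i != j -> independent_functions P (inc i) (inc j).
Proof.
move=> ij.
have tseq : time_sequence (fun i => i%:R : R).
  by split => // n; rewrite ltr_nat.
exact: (mutually_independent_pairwise _ _ _ _ _ (levy_indep levyD tseq)).
Qed.

(** D at integer n is a sum of n increments distributed as D(1). Integer times are enough because G
    is integer-valued. *)
Lemma levy_mean n : has_mean P (D n%:R) (n%:R * d1).
Proof.
rewrite (_ : (D n%:R : T -> R) = fun w => \sum_(i < n) inc i w).
  by apply: has_mean_partial_sum => i; apply: (has_mean_inc id).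
by apply/funext => w; rewrite sum_inc.
Qed.

Lemma levy_meanM m n : has_mean P (fun w => D m%:R w * D n%:R w)
  ((minn m n)%:R * (d2 - d1 ^+ 2) + m%:R * n%:R * d1 ^+ 2).
Proof.
under eq_fun do rewrite -!sum_inc.
apply: has_mean_partial_sumM => //.
- by move=> i; apply: (has_mean_inc id).
- by move=> i; apply: (has_mean_inc (fun x => x ^+ 2)).
Qed.

End levy_moments.

Section subordinated_poisson.
Context {d} {T : measurableType d} {R : realType} (P : probability T R).
Variables (D : R -> {RV P >-> R}) (N : R -> {RV P >-> nat}) (lambda : R).
Hypothesis lambda0 : 0 < lambda.
Hypothesis subD : levy_subordinator D.
Hypothesis poissonN : poisson_process lambda N.
Hypothesis indND : independent_processes P [set t : R | 0 <= t] (fun t w => N t w)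
  [set t : R | 0 <= t] (fun t w => D t w).

Let Nf := subordinated_poisson (fun t w => N t w) (fun t w => D t w).

Let countN := poisson_counting poissonN.
Let D0 t w : 0 <= t -> 0 <= D t w.
Proof. by move=> t0; rewrite -(levy_start subD.1 w); exact: subD.2. Qed.

Let mNk t k : measurable (N t @^-1` [set k]).
Proof. exact: measurable_nat_preimage. Qed.

Let poisson_law_int s t k : 0 <= s -> s < t ->
  P [set w | N t w = (N s w + k)%N] =
  (\int[P]_w (poisson_pmf (cst lambda w * (t - s)) k)%:E)%E.
Proof.
move=> s0 st; rewrite (poisson_law poissonN k s0 st).
transitivity (\int[P]_w (cst (poisson_pmf (lambda * (t - s)) k)%:E w))%E => //.
by rewrite integral_cst//= probability_setT mule1.
Qed.

Lemma poisson_mean t : 0 <= t -> has_mean P (fun w => (N t w)%:R) (t * lambda).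
Proof.
move=> t0; apply: (mixed_poisson_mean P (fun t w => N t w)
  (cst lambda) lambda (lambda ^+ 2)) => //.
- exact: counting_start countN.
- exact: counting_mono countN.
- by apply: aeW => w; exact: lambda0.
- exact: has_mean_cst.
- exact: (has_mean_cst P (lambda ^+ 2)).
Qed.

Lemma poisson_meanM s t : 0 <= s -> 0 <= t ->
  has_mean P (fun w => (N s w)%:R * (N t w)%:R)
    (Num.min s t * lambda + s * t * lambda ^+ 2).
Proof.
move=> s0 t0; apply: (mixed_poisson_meanM P (fun t w => N t w)
  (cst lambda) lambda (lambda ^+ 2)) => //.
- exact: counting_start countN.
- exact: counting_mono countN.
- by apply: aeW => w; exact: lambda0.
- exact: has_mean_cst.
- exact: (has_mean_cst P (lambda ^+ 2)).
Qed.

Lemma measurable_subordinated_poisson t k : 0 <= t ->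
  measurable (Nf t @^-1` [set k]).
Proof.
move=> t0; apply: (measurable_time_change (fun t w => N t w) (D t)) => //.
- exact: counting_mono countN.
- by move=> w u u0; have [+ _] := counting_cadlag countN w; apply.
- by move=> w; exact: D0.
Qed.

Lemma measurable_subordinated_poisson_natr t : 0 <= t ->
  measurable_fun setT (fun w => (Nf t w)%:R : R).
Proof.
move=> t0; apply: (measurable_fun_of_nat _ (Nf t) (fun k => k%:R)) => k.
exact: measurable_subordinated_poisson.
Qed.

Let indND_event (f : process_sigmaType [set t : R | 0 <= t] (fun t w => N t w) -> R)
    s t (A B : set R) :
  measurable_fun setT f -> 0 <= s -> 0 <= t -> measurable A -> measurable B ->
  independent_of_event P f (D s @^-1` A `&` D t @^-1` B).
Proof.
move=> mf s0 t0 mA mB C mC; apply: indND.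
  exact: process_sigma_preimage.
by apply: process_sigmaI; apply: process_sigma_preimage => //;
  apply: (measurable_process [set t : R | 0 <= t] (fun t w => D t w)).
Qed.

Let measurable_natr_process u : 0 <= u -> measurable_fun setT
  (fun w : process_sigmaType [set t : R | 0 <= t] (fun t w => N t w) =>
     (N u w)%:R : R).
Proof.
move=> u0; apply: (measurable_fun_of_nat _ _ (fun k => k%:R : R)) => k.
apply: measurable_nat_preimage.
exact: (measurable_process [set t : R | 0 <= t] (fun t w => N t w)).
Qed.

Lemma subordinated_poisson_mean t a : 0 <= t -> has_mean P (D t) a ->
  has_mean P (fun w => (Nf t w)%:R) (a * lambda).
Proof.
move=> t0 Da.
(* The second time is a dummy and is set to [D t] as well. *)
apply: (has_mean_time_change P (fun u _ w => (N u w)%:R) (fun u _ => u * lambda)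
  (D t) (D t) _ _ _ _ _ _ _ _ a a lambda (a * lambda)) => //.
- by move=> w; exact: D0.
- by move=> w; exact: D0.
- by move=> u v u0 _; exact: poisson_mean.
- move=> u v A B u0 v0 mA mB; apply: indND_event => //.
  exact: measurable_natr_process.
- by move=> u v u' v' w u0 v0 uu' vv'; rewrite ler_nat; exact: (counting_mono countN).
- by under eq_fun do rewrite mulrC; rewrite mulrC; exact: has_meanZ.
- move=> u v r u0 v0 /andP[r0 r1]; rewrite mulrDl lerD2l ler_wpM2l//.
  by apply: ler_peMr; rewrite ?(ltW lambda0)// -addrA lerDl addr_ge0.
- exact: ltW.
- exact: measurable_subordinated_poisson_natr.
Qed.

Lemma subordinated_poisson_meanM s t a b m : 0 <= s -> s <= t ->
  has_mean P (D s) a -> has_mean P (D t) b -> has_mean P (fun w => D s w * D t w) m ->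
  has_mean P (fun w => (Nf s w)%:R * (Nf t w)%:R) (a * lambda + m * lambda ^+ 2).
Proof.
move=> s0 st Da Db Dm; have t0 := le_trans s0 st.
apply: (has_mean_time_change P (fun u v w => (N u w)%:R * (N v w)%:R)
  (fun u v => Num.min u v * lambda + u * v * lambda ^+ 2)
  (D s) (D t) _ _ _ _ _ _ _ _ a b (lambda + lambda ^+ 2)) => //.
- by move=> w; exact: D0.
- by move=> w; exact: D0.
- by move=> u v u0 v0; exact: poisson_meanM.
- move=> u v A B u0 v0 mA mB; apply: indND_event => //.
  by apply: measurable_funM; exact: measurable_natr_process.
- move=> u v u' v' w u0 v0 uu' vv'.
  by apply: ler_pM => //; rewrite ler_nat; exact: (counting_mono countN).
- under eq_fun do rewrite min_l ?subD.2//.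
  under eq_fun do rewrite (mulrC _ lambda) (mulrC _ (lambda ^+ 2)).
  by rewrite mulrC (mulrC m); apply: has_meanD; exact: has_meanZ.
- move=> u v r u0 v0 /andP[r0 r1]; rewrite -addr_minl -subr_ge0.
  (* The slack in the increment bound with c = lambda + lambda^2; its last term is nonnegative
     because r <= 1. *)
  have -> : Num.min u v * lambda + u * v * lambda ^+ 2 +
      r * ((lambda + lambda ^+ 2) * (1 + u + v)) -
      ((Num.min u v + r) * lambda + (u + r) * (v + r) * lambda ^+ 2) =
    r * (lambda * (u + v) + lambda ^+ 2 * (1 - r)) by ring.
  apply: mulr_ge0 => //; apply: addr_ge0; apply: mulr_ge0 => //.
  - exact: ltW.
  - exact: addr_ge0.
  - exact: sqr_ge0.
  - by rewrite subr_ge0.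
- by rewrite addr_ge0 ?sqr_ge0// ltW.
- by apply: measurable_funM; exact: measurable_subordinated_poisson_natr.
Qed.

(* N at the grid point below D t is at most Nf t, and its second moment is a
   quadratic function of that grid point. *)
Lemma subordinator_square_integrable t : 0 <= t ->
  (\int[P]_w ((Nf t w)%:R ^+ 2)%:E < +oo)%E ->
  exists d2, has_mean P (fun w => D t w ^+ 2) d2.
Proof.
move=> t0 Nfoo; have mNf := measurable_subordinated_poisson_natr _ t0.
have [n2 Nf2] : exists n2, has_mean P (fun w => (Nf t w)%:R ^+ 2) n2.
  by apply: has_mean_lty => //; exact: measurable_funX.
pose Z u (_ : R) w : R := (N u w)%:R * (N u w)%:R.
pose phi (u _ : R) := Num.min u u * lambda + u * u * lambda ^+ 2.
(* Mesh 1 is fine enough, as D t <= g + 1 and only finiteness is at stake. *)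
pose g w : R := grid 1 0 (D t w).
have mD : measurable_fun setT (D t) by exact: measurable_funP.
have Dt0 w : 0 <= D t w by exact: D0.
have g0 w : 0 <= g w by exact: grid_ge0.
have Z0 u v w : 0 <= u -> 0 <= v -> 0 <= Z u v w by rewrite /Z mulr_ge0.
have Zphi u v : 0 <= u -> 0 <= v -> has_mean P (Z u v) (phi u v).
  by move=> u0 _; exact: poisson_meanM.
have Zind u v (A B : set R) : 0 <= u -> 0 <= v -> measurable A -> measurable B ->
    independent_of_event P (Z u v) (D t @^-1` A `&` D t @^-1` B).
  move=> u0 v0 mA mB; apply: indND_event => //.
  by apply: measurable_funM; exact: measurable_natr_process.
have [l Zl] : exists l, has_mean P (fun w => Z (g w) (g w) w) l.
  apply: (has_mean_dominated _ _ _ _ _ _ Nf2).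
    exact: (measurable_grid P Z phi (D t) (D t)).
  move=> w; rewrite ger0_norm ?Z0// /Z -expr2 ler_pXn2r ?nnegrE// ler_nat.
  apply: (counting_mono countN) => //.
  exact: grid0_le.
have phil : has_mean P (fun w => phi (g w) (g w)) l.
  apply: has_mean_ge0.
  - exact: (measurable_grid_mean phi (D t) (D t)).
  - move=> w; rewrite /phi minxx.
    by apply: addr_ge0; rewrite mulr_ge0 ?sqr_ge0 ?mulr_ge0 ?(ltW lambda0).
  - by rewrite -(ge0_integral_grid P Z phi (D t) (D t))// Zl.2.
have lambda_neq0 : lambda != 0 by rewrite gt_eqF.
(* Since phi(g, g) = lambda g + lambda^2 g^2, this dominates 2 g^2 + 2 = (g + 1)^2 + (g - 1)^2,
   hence (D t)^2. *)
apply: (has_mean_dominated _ _ (fun w => 2 * lambda ^- 2 * phi (g w) (g w) + 2)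
  (2 * lambda ^- 2 * l + 2)).
- exact: measurable_funX.
- move=> w; rewrite ger0_norm ?sqr_ge0//.
  have gD : D t w <= g w + 1 by rewrite /g -grid1; exact: le_grid1.
  have gD2 : D t w ^+ 2 <= (g w + 1) ^+ 2.
    by rewrite ler_pXn2r ?nnegrE ?addr_ge0.
  apply: (le_trans gD2).
  have -> : 2 * lambda ^- 2 * phi (g w) (g w) + 2 =
      (g w + 1) ^+ 2 + (2 * g w / lambda + (g w - 1) ^+ 2).
    by rewrite /phi minxx; field.
  rewrite lerDl addr_ge0 ?sqr_ge0//.
  by rewrite mulr_ge0 ?invr_ge0 ?(ltW lambda0)// mulr_ge0.
- apply: has_meanD; last exact: has_mean_cst.
  exact: (has_meanZ P (2 * lambda ^- 2) _ l phil).
Qed.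

End subordinated_poisson.

(** Open right half-lines are stable under intersection, generate the Borel sets and exhaust the
    line; their mass is 1 minus the distribution function. *)
Lemma cdf_same_law d (T : measurableType d) (R : realType) (P : probability T R)
  (X Y : {RV P >-> R}) : cdf X = cdf Y -> same_law P X Y.
Proof.
move=> cdfXY B mB.
apply: (measure_unique (@RGenOInfty.G R) (fun n => `](- n%:R), +oo[%classic) _ _ _ _
  (distribution P X) (distribution P Y)) => //.
- exact: RGenOInfty.measurableE.
- move=> _ _ [x ->] [y ->]; exists (Num.max x y).
  by apply/seteqP; split => z /=; rewrite !in_itv/= !andbT gt_max => /andP.
- by move=> n; exists (- n%:R).
- apply/seteqP; split => // x _; exists (Num.truncn (- x)).+1 => //=.
  by rewrite in_itv/= andbT ltrNl truncnS_gt.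
- move=> _ [x ->]; rewrite -[LHS]/(ccdf X x) -[RHS]/(ccdf Y x).
  by rewrite !ccdf_1_cdf cdfXY.
- by move=> k; rewrite (le_lt_trans (probability_le1 _ _))// ltry.
Qed.

(** * Moments of the geometric counting process *)

Section geometric_counting.
Context {d} {T : measurableType d} {R : realType} (P : probability T R).
Variables (mu : R) (G : R -> {RV P >-> nat}).
Hypotheses (mu0 : 0 < mu) (geoG : geometric_counting_process mu G).

Lemma geometric_counting_counting : counting_process G.
Proof. by have [L [_ []]] := geoG. Qed.

Let increments_law (L : {RV P >-> R}) s t k : mixed_poisson_process L G ->
  0 <= s -> s < t ->
  P [set w | G t w = (G s w + k)%N] =
  (\int[P]_w (poisson_pmf (L w * (t - s)) k)%:E)%E.
Proof.
(* The times s, t, t + 1, ... extend s < t to an infinite increasing sequence; only its first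
   interval is used, with no constraint on [L]. *)
move=> [_ mixG] s0 st; pose u i : R := if i is j.+1 then t + j%:R else s.
have tu : time_sequence u.
  by split => // -[|i] /=; [rewrite addr0|rewrite ltrD2l ltr_nat].
have := mixG 1%N u (fun=> k) setT tu measurableT.
rewrite preimage_setT setTI.
under eq_integral do rewrite big_ord_recl big_ord0 mulr1 /= addr0.
move=> <-; congr (P _); apply/seteqP; split => w /=.
  by move=> Gw [|i]//= _; rewrite addr0.
by move=> /(_ 0%N); rewrite /= addr0; apply.
Qed.

Lemma geometric_counting_mean t : 0 <= t ->
  has_mean P (fun w => (G t w)%:R) (mu * t).
Proof.
have [L [lawL mixG]] := geoG => t0; rewrite mulrC.
have cG := geometric_counting_counting.
apply: (mixed_poisson_mean P (fun t w => G t w) L mu (2 * mu ^+ 2)) => //.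
- by move=> u k; exact: measurable_nat_preimage.
- exact: counting_start cG.
- exact: counting_mono cG.
- exact: exponential_gt0 lawL.
- by move=> *; exact: increments_law.
- exact: exponential_mean.
- exact: exponential_second_moment.
Qed.

Lemma geometric_counting_meanM s t : 0 <= s -> 0 <= t ->
  has_mean P (fun w => (G s w)%:R * (G t w)%:R)
    (mu * Num.min s t + 2 * mu ^+ 2 * (s * t)).
Proof.
have [L [lawL mixG]] := geoG => s0 t0; rewrite (mulrC mu) (mulrC (2 * _)).
have cG := geometric_counting_counting.
apply: (mixed_poisson_meanM P (fun t w => G t w) L mu (2 * mu ^+ 2)) => //.
- by move=> u k; exact: measurable_nat_preimage.
- exact: counting_start cG.
- exact: counting_mono cG.
- exact: exponential_gt0 lawL.
- by move=> *; exact: increments_law.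
- exact: exponential_mean.
- exact: exponential_second_moment.
Qed.

End geometric_counting.

(** * The geometric subordinated compound Poisson process *)

Theorem theorem2 (d : measure_display) (T : measurableType d) (R : realType)
    (P : probability T R)
    (D : R -> {RV P >-> R}) (N : R -> {RV P >-> nat})
    (X : nat -> {RV P >-> R}) (G : R -> {RV P >-> nat})
    (b lambda mu : R) (nu : {measure set R -> \bar R}) (FX : R -> \bar R)
    (Nf : R -> T -> nat) (Yf Ymu : R -> T -> R)
    (hNf : Nf = subordinated_poisson (fun t w => N t w) (fun t w => D t w))
    (hYf : Yf = compound_process Nf (fun i w => X i w))
    (hYmu : Ymu = geometric_subordinated Yf (fun t w => G t w))
    (hb : 0 <= b) (hlambda : 0 < lambda) (hmu : 0 < mu)
    (hnu : levy_measure nu)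
    (hD : levy_subordinator D)
    (hDf : has_laplace_exponent D (bernstein b nu))
    (hN : poisson_process lambda N)
    (hND : independent_processes P [set t : R | 0 <= t] (fun t w => N t w)
             [set t : R | 0 <= t] (fun t w => D t w))
    (hX : iid X FX)
    (hXNf : independent_processes P [set: nat] (fun i w => X i w)
              [set t : R | 0 <= t] Nf)
    (hG : geometric_counting_process mu G)
    (hGY : independent_processes P [set t : R | 0 <= t] (fun t w => G t w)
             [set t : R | 0 <= t] Yf)
    (hX2 : ('E_P[fun w => ((X 0%N w) ^+ 2)%R] < +oo)%E)
    (hNfr : forall r t : R, 0 < r -> 0 <= t ->
              ('E_P[fun w => ((Nf t w)%:R `^ r)%R] < +oo)%E)
    (s t : R) (hs : 0 < s) (hst : s <= t) :
  [/\ 'E_P[Ymu t] = (lambda * mu * t)%:E * 'E_P[D 1%R] * 'E_P[X 0%N],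
      'V_P[Ymu t] =
        (lambda * mu * t)%:E *
          ('E_P[D 1%R] * 'V_P[X 0%N] +
           'E_P[X 0%N] ^+ 2 * (lambda%:E * 'V_P[D 1%R] + 'E_P[D 1%R])) +
        (lambda ^+ 2 * mu * t)%:E * 'E_P[D 1%R] ^+ 2 * 'E_P[X 0%N] ^+ 2 *
          (1 + mu * t)%:E
    & covariance P (Ymu t) (Ymu s) =
        (mu * s)%:E *
          (lambda%:E * 'E_P[fun w => ((X 0%N w) ^+ 2)%R] * 'E_P[D 1%R] +
           'E_P[X 0%N] ^+ 2 * (lambda ^+ 2)%:E * 'V_P[D 1%R]) +
        (lambda ^+ 2)%:E * 'E_P[D 1%R] ^+ 2 * 'E_P[X 0%N] ^+ 2 *
          (mu * s * (1 + mu * t))%:E]%E.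
Proof.
have t0 : 0 < t by exact: lt_le_trans hst.
have levyD := hD.1.
have countN := poisson_counting hN.
have mNf u k : 0 <= u -> measurable (Nf u @^-1` [set k]).
  by move=> u0; rewrite hNf; exact: (measurable_subordinated_poisson P D N lambda).
have [x2 X2] : exists x2, has_mean P (fun w => X 0%N w ^+ 2) x2.
  apply: has_mean_lty; first exact: measurable_funX.
    by move=> w; exact: sqr_ge0.
  by move: hX2; rewrite unlock.
have [x1 X1] : exists x1, has_mean P (X 0%N) x1.
  exact: has_mean_square_integrable X2.
(* Square integrability of D(1) comes from the second moment of N^f(1), that is [hNfr] at r = 2. *)
have [d2 D2] : exists d2, has_mean P (fun w => D 1 w ^+ 2) d2.
  apply: (subordinator_square_integrable P D N lambda) => //.
  rewrite -hNf; have := hNfr 2 1 (ltr0n _ 2) ler01; rewrite unlock.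
  by under eq_integral do rewrite (powR_mulrn 2)//.
have [d1 D1] : exists d1, has_mean P (D 1) d1.
  exact: has_mean_square_integrable D2.
have Nf1 n : has_mean P (fun w => (Nf n%:R w)%:R) (n%:R * (d1 * lambda)).
  rewrite hNf mulrA; apply: subordinated_poisson_mean => //.
  exact: levy_mean.
pose v := d2 - d1 ^+ 2.
have Nf2 m n : has_mean P (fun w => (Nf m%:R w)%:R * (Nf n%:R w)%:R)
    ((minn m n)%:R * (d1 * lambda + v * lambda ^+ 2) +
     m%:R * n%:R * (d1 ^+ 2 * lambda ^+ 2)).
  wlog mn : m n / (m <= n)%N.
    move=> H; have /orP[|nm] := leq_total m n; first exact: H.
    by under eq_fun do rewrite mulrC; rewrite minnC (mulrC m%:R); exact: H.
  have mnR : m%:R <= n%:R :> R by rewrite ler_nat.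
  have := subordinated_poisson_meanM P D N lambda hlambda hD hN hND m%:R n%:R
    _ _ _ (ler0n _ _) mnR (levy_mean P D d1 levyD D1 m)
    (levy_mean P D d1 levyD D1 n) (levy_meanM P D d1 d2 levyD D1 D2 m n).
  by rewrite hNf (minn_idPl mn); congr (has_mean _ _ _); rewrite /v; ring.
have sumX n : measurable_fun setT
    (fun w : process_sigmaType [set: nat] (fun i w => X i w) => \sum_(i < n) X i w).
  apply: measurable_sum => i.
  exact: (measurable_process [set: nat] (fun i w => X i w)).
have XNf (f : process_sigmaType [set: nat] (fun i w => X i w) -> R) m n i j :
    measurable_fun setT f ->
    independent_of_event P f (Nf m%:R @^-1` [set i] `&` Nf n%:R @^-1` [set j]).
  move=> mf B mB; apply: hXNf; first exact: process_sigma_preimage.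
  by apply: process_sigmaI; apply: process_sigma_preimage => //;
    apply: (measurable_process [set t : R | 0 <= t] Nf); exact: ler0n.
have lawX i (h : R -> R) m : measurable_fun setT h ->
    has_mean P (h \o X 0%N) m -> has_mean P (h \o X i) m.
  move=> mh; apply: has_mean_same_law => //.
  by apply: cdf_same_law; rewrite !hX.2.
have Xi1 i : has_mean P (X i) x1 by exact: (lawX i id).
have Xi2 i : has_mean P (fun w => X i w ^+ 2) x2.
  exact: (lawX i (fun x => x ^+ 2)).
have indX i j : i != j -> independent_functions P (X i) (X j).
  exact: (mutually_independent_pairwise _ _ _ _ _ hX.1).
pose S n w := \sum_(i < n) X i w.
have S1 n : has_mean P (S n) (n%:R * x1).
  exact: (has_mean_partial_sum P (fun i w => X i w)).
have S2 m n := has_mean_partial_sumM P (fun i w => X i w) x1 x2 m n Xi1 Xi2 indX.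
(* Paths of N^f are nondecreasing, so the mean of the minimum is already given by [Nf1]. *)
have minNf m n w : minn (Nf m%:R w) (Nf n%:R w) = Nf (minn m n)%:R w.
  have Nf_mono i j : (i <= j)%N -> (Nf i%:R w <= Nf j%:R w)%N.
    move=> ij; rewrite hNf; apply: (counting_mono countN).
      by rewrite -(levy_start levyD w); apply: hD.2.
    by apply: hD.2 => //; rewrite ler_nat.
  have /orP[mn|nm] := leq_total m n.
    by rewrite (minn_idPl mn) (minn_idPl (Nf_mono _ _ mn)).
  by rewrite (minn_idPr nm) (minn_idPr (Nf_mono _ _ nm)).
have Yf1 n : has_mean P (Yf n%:R) (n%:R * (d1 * lambda * x1)).
  rewrite hYf mulrA; apply: (random_index_mean P S x1 _ _ (Nf n%:R)
    (fun k => mNf _ k (ler0n _ n)) S1 S2 _ _ (Nf1 n) (Nf2 n n)).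
  move=> m; rewrite -(setIid (_ @^-1` _)).
  exact: (XNf (S m) n n m m (sumX m)).
(* A is the variance of Y^f(1) and B below the square of its mean: Y^f at integer times is of type
   (d1 lambda x1, A, B). *)
pose A := d1 * lambda * x2 + v * lambda ^+ 2 * x1 ^+ 2.
pose B := d1 ^+ 2 * lambda ^+ 2 * x1 ^+ 2.
have Yf2 m n : has_mean P (fun w => Yf m%:R w * Yf n%:R w)
    ((minn m n)%:R * A + m%:R * n%:R * B).
  have minmn : has_mean P (fun w => (minn (Nf m%:R w) (Nf n%:R w))%:R)
      ((minn m n)%:R * (d1 * lambda)).
    by under eq_fun do rewrite minNf; exact: Nf1.
  rewrite hYf (_ : _ + _ = (minn m n)%:R * (d1 * lambda) * (x2 - x1 ^+ 2) +
    ((minn m n)%:R * (d1 * lambda + v * lambda ^+ 2) +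
     m%:R * n%:R * (d1 ^+ 2 * lambda ^+ 2)) * x1 ^+ 2); last by rewrite /A /B; ring.
  apply: (random_index_meanM P S (x2 - x1 ^+ 2) (x1 ^+ 2) (Nf m%:R) (Nf n%:R)
    (fun k => mNf _ k (ler0n _ m)) (fun k => mNf _ k (ler0n _ n)) S2 _ _ _ _ _ _
    (Nf1 m) (Nf2 m m) (Nf1 n) (Nf2 n n) minmn (Nf2 m n)).
  move=> i j; apply: (XNf (fun w => S i w * S j w)).
  by apply: measurable_funM; exact: sumX.
have GYf (f : process_sigmaType [set t : R | 0 <= t] Yf -> R) u u' i j :
    measurable_fun setT f -> 0 <= u -> 0 <= u' ->
    independent_of_event P f (G u @^-1` [set i] `&` G u' @^-1` [set j]).
  move=> mf u0 u'0 C mC; rewrite setIC muleC; apply: hGY.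
    by apply: process_sigmaI; apply: process_sigma_preimage => //;
      apply: (measurable_process [set t : R | 0 <= t] (fun t w => G t w)).
  exact: process_sigma_preimage.
have mYf n : measurable_fun setT
    (Yf n%:R : process_sigmaType [set t : R | 0 <= t] Yf -> R).
  by apply: (measurable_process [set t : R | 0 <= t] Yf); exact: ler0n.
have countG := geometric_counting_counting P mu G hG.
have G1 u : 0 <= u -> has_mean P (fun w => (G u w)%:R) (mu * u).
  exact: geometric_counting_mean.
have G2 u u' : 0 <= u -> 0 <= u' -> has_mean P (fun w => (G u w)%:R * (G u' w)%:R)
    (mu * Num.min u u' + 2 * mu ^+ 2 * (u * u')).
  exact: geometric_counting_meanM.
have mG u k : measurable (G u @^-1` [set k]) by exact: measurable_nat_preimage.
(* Second use of random indices: the sequence is now Y^f(n), the index G(u). *)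
have Ymu1 u : 0 <= u -> has_mean P (Ymu u) (mu * u * (d1 * lambda * x1)).
  move=> u0; rewrite hYmu.
  apply: (random_index_mean P (fun n => Yf n%:R) _ _ _ (G u) (mG u) Yf1 Yf2 _ _
    (G1 u u0) (G2 u u u0 u0)).
  move=> m; rewrite -(setIid (_ @^-1` _)).
  exact: (GYf (Yf m%:R)).
have Ymu2 u u' : 0 <= u -> 0 <= u' -> has_mean P (fun w => Ymu u w * Ymu u' w)
    (mu * Num.min u u' * A + (mu * Num.min u u' + 2 * mu ^+ 2 * (u * u')) * B).
  move=> u0 u'0; rewrite hYmu.
  have minG w : minn (G u w) (G u' w) = G (Num.min u u') w.
    have /orP[uu'|u'u] := le_total u u'.
      by rewrite (min_l uu') (minn_idPl (counting_mono countG w u0 uu')).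
    by rewrite (min_r u'u) (minn_idPr (counting_mono countG w u'0 u'u)).
  have minuu' : has_mean P (fun w => (minn (G u w) (G u' w))%:R) (mu * Num.min u u').
    by under eq_fun do rewrite minG; apply: G1; rewrite le_min u0.
  apply: (random_index_meanM P (fun n => Yf n%:R) A B (G u) (G u') (mG u) (mG u')
    Yf2 _ _ _ _ _ _ (G1 u u0) (G2 u u u0 u0) (G1 u' u'0) (G2 u' u' u'0 u'0)
    minuu' (G2 u u' u0 u'0)).
  move=> m n; apply: (GYf (fun w => Yf m%:R w * Yf n%:R w)) => //.
  by apply: measurable_funM; exact: mYf.
have [Yt Ys] := (Ymu1 t (ltW t0), Ymu1 s (ltW hs)).
have [Ytt Yts] := (Ymu2 t t (ltW t0) (ltW t0), Ymu2 t s (ltW t0) (ltW hs)).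
(* Subtracting the product of the means lowers the coefficient of mu^2 u u' B from 2 to 1, which
   produces the factor 1 + mu t. *)
rewrite /variance (has_mean_expectation _ _ _ Yt).
rewrite (has_mean_covariance _ _ _ _ _ _ Yt Yt Ytt).
rewrite (has_mean_covariance _ _ _ _ _ _ Yt Ys Yts).
rewrite (has_mean_covariance _ _ _ _ _ _ X1 X1 X2).
rewrite (has_mean_covariance _ _ _ _ _ _ D1 D1 D2).
rewrite (has_mean_expectation _ _ _ X1) (has_mean_expectation _ _ _ X2).
rewrite (has_mean_expectation _ _ _ D1).
rewrite minxx min_r// /A /B /v.
rewrite -!EFin_expe; do 6 (rewrite -?EFinM -?EFinD).
split; congr EFin; ring.
Qed.
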